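(* Let $a>0$, let $\kappa\ge \tfrac12$ be real, let $p_1,p_2,q,r_{11},r_{12},r_{21},r_{22}\in C([0,a])$ be complex-valued with $p_1(0)\neq 0$, and let $\lambda\in\mathbb{C}$. Suppose that the homogeneous system $$v'+p_1u+\Big(\frac{\kappa}{x}+q\Big)v=0,\qquad -u'+\Big(\frac{\kappa}{x}+q\Big)u+p_2v=0,\qquad x\in(0,a],$$ possesses a solution $(u,v)=(f,g)$ such that $$f(x)\sim x^\kappa,\qquad g(x)\sim \frac{-p_1(0)}{2\kappa+1}x^{\kappa+1},\qquad x\to0,$$ and $f$ does not vanish except at $x=0$ (i.e. $f(x)\ne0$ for all $x\in(0,a]$). Let $\widehat X^{(n)},\widehat Y^{(n)}$, $n\ge0$, be the formal powers constructed from $(f,g)$ as defined in the context. Then a regular solution (in the sense defined in the context) of the system $$v'+p_1u+\Big(\frac{\kappa}{x}+q\Big)v=\lambda(r_{11}u+r_{12}v),\qquad -u'+\Big(\frac{\kappa}{x}+q\Big)u+p_2v=\lambda(r_{21}u+r_{22}v),\qquad x\in(0,a],$$ is given by the (convergent) series $$\begin{pmatrix}u\\ v\end{pmatrix}=\sum_{n=0}^\infty\frac{\lambda^n}{n!}\begin{pmatrix}\widehat X^{(n)}\\ \widehat Y^{(n)}\end{pmatrix}.$$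
   Context: Formal powers: $\widehat X^{(0)}=f$, $\widehat Y^{(0)}=g$, and for $n\ge0$ and $x\in(0,a]$, $$\widehat Z^{(n)}(x)=\int_0^x\Big(\widehat X^{(n)}(t)\big(f(t)r_{11}(t)+g(t)r_{21}(t)\big)+\widehat Y^{(n)}(t)\big(f(t)r_{12}(t)+g(t)r_{22}(t)\big)\Big)dt,$$ $$\widehat X^{(n+1)}(x)=(n+1)f(x)\int_0^x\Big(-\frac{r_{21}(t)}{f(t)}\widehat X^{(n)}(t)-\frac{r_{22}(t)}{f(t)}\widehat Y^{(n)}(t)+\frac{p_2(t)}{f^2(t)}\widehat Z^{(n)}(t)\Big)dt,$$ $$\widehat Y^{(n+1)}(x)=(n+1)\frac{1}{f(x)}\widehat Z^{(n)}(x)+\frac{g(x)}{f(x)}\widehat X^{(n+1)}(x).$$ Regular solution: a solution $(u,v)$ on $(0,a]$ of the system with parameter $\lambda$ such that $u$ and $v$ are bounded at the origin and, as $x\to0$, $$u(x)\sim x^\kappa,\quad u'(x)\sim\kappa x^{\kappa-1},\quad v(x)\sim\mu x^{\kappa+1},\quad v'(x)\sim\mu(\kappa+1)x^\kappa,\qquad \mu=\mu(\lambda)=\frac{\lambda r_{11}(0)-p_1(0)}{2\kappa+1}.$$ If $\mu=0$, the asymptotic relation for $v$ is to be read as $v(x)=o(x^{\kappa+1})$. Here $f_1(x)\sim f_2(x)$, $x\to0$, means $f_1(x)=f_2(x)[1+o(1)]$ as $x\to0$. Solutions are functions continuously differentiable on $(0,a]$. *)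

(* Defs.v *)
From Stdlib Require Import Reals.
From Coquelicot Require Import Coquelicot.

Open Scope R_scope.

Definition cpower (x k : R) : C := RtoC (Rpower x k).

Definition Icc0 (a x : R) : Prop := 0 <= x <= a.
Definition Ioc0 (a x : R) : Prop := 0 < x <= a.

(* Derivative of a complex-valued function of a real variable relative to [D]:
   at the right endpoint of (0,a] it is the left derivative. *)
Definition is_derive_within (D : R -> Prop) (f : R -> C) (x : R) (l : C) : Prop :=
  filterdiff (U := R_NormedModule) (V := C_R_NormedModule)
    f (within D (locally x))
    (fun y : R => scal (V := C_R_NormedModule) y l).

Definition C1_with_derivative (D : R -> Prop) (f df : R -> C) : Prop :=
  (forall x, D x -> is_derive_within D f x (df x)) /\ continuous_on D df.

(* f1 = f2 o(1) and f1 = f2 [1 + o(1)] as x -> 0+. *)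
Definition little_o (f1 f2 : R -> C) : Prop :=
  exists eps : R -> C,
    filterlim eps (at_right 0) (locally (RtoC 0)) /\
    at_right 0 (fun x => f1 x = (f2 x * eps x)%C).

Definition asymp_equiv (f1 f2 : R -> C) : Prop :=
  exists eps : R -> C,
    filterlim eps (at_right 0) (locally (RtoC 0)) /\
    at_right 0 (fun x => f1 x = (f2 x * (1 + eps x))%C).

(* f(x) ~ c x^k, read as f(x) = o(x^k) when c = 0. *)
Definition asymp_power (f : R -> C) (c : C) (k : R) : Prop :=
  (c <> RtoC 0 -> asymp_equiv f (fun x => (c * cpower x k)%C)) /\
  (c = RtoC 0 -> little_o f (fun x => cpower x k)).

Definition bounded_at_0 (f : R -> C) : Prop :=
  exists M : R, at_right 0 (fun x => Cmod (f x) <= M).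

(* (u,v), with derivatives (du,dv), is a C^1 solution on (0,a] of
     v' + p1 u + (kappa/x + q) v = h1,   - u' + (kappa/x + q) u + p2 v = h2. *)
Definition dirac_system (a kappa : R) (p1 p2 q h1 h2 u v du dv : R -> C) : Prop :=
  C1_with_derivative (Ioc0 a) u du /\
  C1_with_derivative (Ioc0 a) v dv /\
  forall x, Ioc0 a x ->
    (dv x + p1 x * u x + (RtoC (kappa / x) + q x) * v x)%C = h1 x /\
    (- du x + (RtoC (kappa / x) + q x) * u x + p2 x * v x)%C = h2 x.

Definition homogeneous_solution (a kappa : R) (p1 p2 q u v : R -> C) : Prop :=
  exists du dv : R -> C,
    dirac_system a kappa p1 p2 q
      (fun _ => RtoC 0) (fun _ => RtoC 0) u v du dv.

Definition regular_solution (a kappa : R)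
    (p1 p2 q r11 r12 r21 r22 : R -> C) (lambda : C) (u v : R -> C) : Prop :=
  let mu := ((lambda * r11 0 - p1 0) / RtoC (2 * kappa + 1))%C in
  exists du dv : R -> C,
    dirac_system a kappa p1 p2 q
      (fun x => lambda * (r11 x * u x + r12 x * v x))%C
      (fun x => lambda * (r21 x * u x + r22 x * v x))%C
      u v du dv /\
    bounded_at_0 u /\ bounded_at_0 v /\
    asymp_equiv u (fun x => cpower x kappa) /\
    asymp_equiv du (fun x => (RtoC kappa * cpower x (kappa - 1))%C) /\
    asymp_power v mu (kappa + 1) /\
    asymp_power dv (mu * RtoC (kappa + 1))%C kappa.

Definition CRInt (h : R -> C) (b c : R) : C :=
  RInt (V := C_R_CompleteNormedModule) h b c.
Definition ex_CRInt (h : R -> C) (b c : R) : Prop :=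
  ex_RInt (V := C_R_NormedModule) h b c.

Definition Z_integrand (f g r11 r12 r21 r22 X Y : R -> C) (t : R) : C :=
  (X t * (f t * r11 t + g t * r21 t) + Y t * (f t * r12 t + g t * r22 t))%C.

Definition X_integrand (f p2 r21 r22 X Y Z : R -> C) (t : R) : C :=
  (- (r21 t / f t) * X t - r22 t / f t * Y t + p2 t / (f t * f t) * Z t)%C.

Definition Z_of (f g r11 r12 r21 r22 X Y : R -> C) (x : R) : C :=
  CRInt (Z_integrand f g r11 r12 r21 r22 X Y) 0 x.

Fixpoint formal_powers (f g p2 r11 r12 r21 r22 : R -> C) (n : nat)
    : (R -> C) * (R -> C) :=
  match n with
  | O => (f, g)
  | S m =>
      let XY := formal_powers f g p2 r11 r12 r21 r22 m in
      let Z := Z_of f g r11 r12 r21 r22 (fst XY) (snd XY) in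
      let X' := fun x : R =>
        (RtoC (INR (S m)) * f x
         * CRInt (X_integrand f p2 r21 r22 (fst XY) (snd XY) Z) 0 x)%C in
      let Y' := fun x : R =>
        (RtoC (INR (S m)) * (1 / f x) * Z x + g x / f x * X' x)%C in
      (X', Y')
  end.

Definition Xhat (f g p2 r11 r12 r21 r22 : R -> C) (n : nat) : R -> C :=
  fst (formal_powers f g p2 r11 r12 r21 r22 n).
Definition Yhat (f g p2 r11 r12 r21 r22 : R -> C) (n : nat) : R -> C :=
  snd (formal_powers f g p2 r11 r12 r21 r22 n).
Definition Zhat (f g p2 r11 r12 r21 r22 : R -> C) (n : nat) : R -> C :=
  Z_of f g r11 r12 r21 r22
    (Xhat f g p2 r11 r12 r21 r22 n) (Yhat f g p2 r11 r12 r21 r22 n).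

(* [RInt] is total; this says that all the integrals defining the formal powers
   on (0,a] exist. The values of the integrands at 0 are irrelevant. *)
Definition formal_powers_defined (a : R) (f g p2 r11 r12 r21 r22 : R -> C) : Prop :=
  forall (n : nat) (x : R), Ioc0 a x ->
    let X := Xhat f g p2 r11 r12 r21 r22 n in
    let Y := Yhat f g p2 r11 r12 r21 r22 n in
    let Z := Zhat f g p2 r11 r12 r21 r22 n in
    ex_CRInt (Z_integrand f g r11 r12 r21 r22 X Y) 0 x /\
    ex_CRInt (X_integrand f p2 r21 r22 X Y Z) 0 x.

(* Main.v *)
(* Divide by the particular solution: with P = x^(2 kappa), put
   X^(n) = n! f xi_n and Y^(n) = n! (g xi_n + P z_n / f). Since f ~ x^kappa and g = o(x^kappa),
   the recursion for (xi_n, z_n) has kernels continuous on [0,a], once the iterated integrals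
   are written as weighted means P(x)^(-1) int_0^x P w. Hence xi_n and z_n are O((L x)^n / n!),
   the sums xi and om of lambda^n xi_n and lambda^n z_n satisfy a Volterra system, and
   differentiating that system shows that u = f xi, v = g xi + P om / f solve the perturbed
   equations. The asymptotics follow from xi(0) = 1 and om(x) / x -> lambda r11(0) / (2 kappa + 1). *)
Require Import Defs.
From Stdlib Require Import Reals Factorial Arith Lra Lia.
From Coquelicot Require Import Coquelicot.
Open Scope R_scope.

(** * Limits of complex-valued functions *)

(** The obstacle is p2 / f^2 in the formula for X^(n+1): it has the size of x^(-2 kappa) with 2
    kappa >= 1, so in general it is not integrable at 0, and only its product with Z^(n) is. Hence
    Z^(n) is never estimated alone: P is split off from it, and P / f^2, which has a finite limit at
    0, goes into a kernel. The substitution is variation of constants with the columns (f, g) and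
    (0, P / f). The weight is x^(2 kappa) and not f^2 because it is real, positive and increasing. A
    mean with an increasing weight is bounded by the unweighted integral, so the bounds do not
    involve the weight at all. All data continuous on (0,a] with a limit at 0 are extended to
    continuous functions on the whole line. Integrals then exist without side conditions, and
    continuity can be proved by the shape of the term. Only the final derivatives are taken relative
    to (0,a], where the one at a is one-sided. Since mu may vanish, the asymptotics are carried as
    limits of quotients by powers, which do not distinguish this case. *)

Lemma filterlim_Cmod {T : Type} (F : (T -> Prop) -> Prop) {FF : Filter F}
    (h : T -> C) (l : C) :
  filterlim h F (locally l) <->
  (forall eps : R, 0 < eps -> F (fun x => Cmod (h x - l) < eps)).
Proof.
  split.
  - intros H eps He.
    generalize (proj1 (filterlim_locally_ball_norm (U := C_R_NormedModule) h l) H (mkposreal eps He)).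
    apply filter_imp. intros x Hx. rewrite Cmod_norm. exact Hx.
  - intros H. apply (filterlim_locally_ball_norm (U := C_R_NormedModule)).
    intros eps. generalize (H eps (cond_pos eps)).
    apply filter_imp. intros x Hx. rewrite Cmod_norm in Hx. exact Hx.
Qed.

Lemma filterlim_Cplus {T : Type} (F : (T -> Prop) -> Prop) {FF : Filter F}
    (h k : T -> C) (l m : C) :
  filterlim h F (locally l) -> filterlim k F (locally m) ->
  filterlim (fun x => h x + k x)%C F (locally (l + m)%C).
Proof.
  intros Hh Hk.
  eapply filterlim_comp_2; [exact Hh | exact Hk |].
  exact (filterlim_plus (V := C_R_NormedModule) l m).
Qed.

Lemma filterlim_Cmult {T : Type} (F : (T -> Prop) -> Prop) {FF : Filter F}
    (h k : T -> C) (l m : C) :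
  filterlim h F (locally l) -> filterlim k F (locally m) ->
  filterlim (fun x => h x * k x)%C F (locally (l * m)%C).
Proof.
  intros Hh Hk. apply filterlim_Cmod; [exact FF|]. intros eps He.
  pose proof (Cmod_ge_0 l) as Hl. pose proof (Cmod_ge_0 m) as Hm.
  (* With both errors below d <= 1, the three terms of the expansion below add up to at most d (1 +
     |l| + |m|); the 2 makes the final inequality strict. *)
  set (d := Rmin 1 (eps / (2 + Cmod l + Cmod m))).
  assert (Hq : 0 < eps / (2 + Cmod l + Cmod m)) by (apply Rdiv_lt_0_compat; lra).
  assert (Hd : 0 < d) by (apply Rmin_pos; lra).
  assert (Hd1 : d <= 1) by apply Rmin_l.
  assert (Hd2 : d * (2 + Cmod l + Cmod m) <= eps).
  { apply Rle_trans with (eps / (2 + Cmod l + Cmod m) * (2 + Cmod l + Cmod m)).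
    - apply Rmult_le_compat_r; [lra | apply Rmin_r].
    - right. field. lra. }
  pose proof (proj1 (filterlim_Cmod F h l) Hh d Hd) as H1.
  pose proof (proj1 (filterlim_Cmod F k m) Hk d Hd) as H2.
  generalize (filter_and _ _ H1 H2). apply filter_imp. intros x [K1 K2].
  replace (h x * k x - l * m)%C
    with ((h x - l) * (k x - m) + (l * (k x - m) + (h x - l) * m))%C by ring.
  eapply Rle_lt_trans; [apply Cmod_triangle|].
  eapply Rle_lt_trans; [apply Rplus_le_compat_l, Cmod_triangle|].
  rewrite !Cmod_mult.
  pose proof (Cmod_ge_0 (h x - l)%C). pose proof (Cmod_ge_0 (k x - m)%C).
  nra.
Qed.

Lemma filterlim_Copp {T : Type} (F : (T -> Prop) -> Prop) {FF : Filter F}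
    (h : T -> C) (l : C) :
  filterlim h F (locally l) -> filterlim (fun x => - h x)%C F (locally (- l)%C).
Proof.
  intros Hh. eapply filterlim_comp; [exact Hh|].
  exact (filterlim_opp (V := C_R_NormedModule) l).
Qed.

Lemma filterlim_Cminus {T : Type} (F : (T -> Prop) -> Prop) {FF : Filter F}
    (h k : T -> C) (l m : C) :
  filterlim h F (locally l) -> filterlim k F (locally m) ->
  filterlim (fun x => h x - k x)%C F (locally (l - m)%C).
Proof.
  intros Hh Hk. apply filterlim_Cplus; [exact FF | exact Hh |].
  now apply filterlim_Copp.
Qed.

Lemma filterlim_Cinv {T : Type} (F : (T -> Prop) -> Prop) {FF : Filter F}
    (h : T -> C) (l : C) :
  l <> RtoC 0 ->
  filterlim h F (locally l) -> filterlim (fun x => / h x)%C F (locally (/ l)%C).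
Proof.
  intros Hl Hh. apply filterlim_Cmod; [exact FF|]. intros eps He.
  assert (Hc : 0 < Cmod l) by now apply Cmod_gt_0.
  (* The first bound keeps |h x| above |l| / 2; the second then gives |h x - l| < eps |h x| |l|. *)
  set (d := Rmin (Cmod l / 2) (eps * (Cmod l * Cmod l) / 2)).
  assert (Hp : 0 < eps * (Cmod l * Cmod l)) by (repeat apply Rmult_lt_0_compat; lra).
  assert (Hd : 0 < d) by (apply Rmin_pos; lra).
  assert (Hd1 : d <= Cmod l / 2) by apply Rmin_l.
  assert (Hd2 : d <= eps * (Cmod l * Cmod l) / 2) by apply Rmin_r.
  generalize (proj1 (filterlim_Cmod F h l) Hh d Hd). apply filter_imp. intros x K.
  assert (Hx : Cmod l / 2 < Cmod (h x)).
  { pose proof (Cmod_triangle (h x) (l - h x)%C) as Ht.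
    replace (h x + (l - h x))%C with l in Ht by ring.
    replace (l - h x)%C with (- (h x - l))%C in Ht by ring.
    rewrite Cmod_opp in Ht. lra. }
  assert (Hx0 : h x <> RtoC 0).
  { intros E. rewrite E, Cmod_0 in Hx. lra. }
  replace (/ h x - / l)%C with (- ((h x - l) / (h x * l)))%C by (field; auto).
  rewrite Cmod_opp, Cmod_div, Cmod_mult by now apply Cmult_neq_0.
  apply Rmult_lt_reg_r with (Cmod (h x) * Cmod l); [apply Rmult_lt_0_compat; lra|].
  assert (Hne : Cmod (h x) * Cmod l <> 0) by (apply Rmult_integral_contrapositive; split; lra).
  unfold Rdiv at 1. rewrite Rmult_assoc, Rinv_l by exact Hne.
  assert (0 < eps * Cmod l * (Cmod (h x) - Cmod l / 2))
    by (apply Rmult_lt_0_compat; [apply Rmult_lt_0_compat|]; lra).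
  lra.
Qed.

Lemma filterlim_Cdiv {T : Type} (F : (T -> Prop) -> Prop) {FF : Filter F}
    (h k : T -> C) (l m : C) :
  m <> RtoC 0 ->
  filterlim h F (locally l) -> filterlim k F (locally m) ->
  filterlim (fun x => h x / k x)%C F (locally (l / m)%C).
Proof.
  intros Hm Hh Hk. apply filterlim_Cmult; [exact FF | exact Hh |].
  now apply filterlim_Cinv.
Qed.

Lemma filterlim_RtoC {T : Type} (F : (T -> Prop) -> Prop) {FF : Filter F}
    (h : T -> R) (l : R) :
  filterlim h F (locally l) -> filterlim (fun x => RtoC (h x)) F (locally (RtoC l)).
Proof.
  intros H. apply filterlim_Cmod; [exact FF|]. intros eps He.
  generalize (proj1 (filterlim_locally h l) H (mkposreal eps He)).
  apply filter_imp. intros x K. rewrite <- RtoC_minus, Cmod_R. exact K.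
Qed.

Lemma filterlim_Cunique {T : Type} (F : (T -> Prop) -> Prop) {FF : ProperFilter F}
    (h : T -> C) (l m : C) :
  filterlim h F (locally l) -> filterlim h F (locally m) -> l = m.
Proof.
  exact (filterlim_locally_unique (V := C_R_NormedModule) h l m).
Qed.

(** * One-sided limits and continuous extension to the whole line *)

Lemma locally_Rabs (x d : R) (P : R -> Prop) :
  0 < d -> (forall y, Rabs (y - x) < d -> P y) -> locally x P.
Proof. intros Hd H. exists (mkposreal d Hd). exact H. Qed.

Lemma filterlim_within_at_right (x0 b : R) (h : R -> C) (l : C) (D : R -> Prop) :
  x0 < b -> (forall x, x0 < x < b -> D x) ->
  filterlim h (within D (locally x0)) (locally l) ->
  filterlim h (at_right x0) (locally l).
Proof.
  intros Hb HD H P HP. specialize (H P HP).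
  unfold filtermap, at_right, within in *.
  assert (Hd : 0 < b - x0) by lra.
  assert (HL : locally x0 (fun x => x < b)).
  { apply (locally_Rabs _ _ _ Hd). intros y Hy.
    apply Rabs_def2 in Hy. lra. }
  generalize (filter_and _ _ H HL). apply filter_imp. intros x [K1 K2] Hx.
  apply K1, HD. lra.
Qed.

Lemma continuous_at_right (x0 : R) (h : R -> C) :
  continuous h x0 -> filterlim h (at_right x0) (locally (h x0)).
Proof.
  intros H. apply filterlim_filter_le_1 with (2 := H).
  intros P HP. unfold at_right, within. revert HP. apply filter_imp. auto.
Qed.

Lemma continuous_within (D : R -> Prop) (x : R) (h : R -> C) :
  continuous h x -> filterlim h (within D (locally x)) (locally (h x)).
Proof.
  intros H. apply filterlim_filter_le_1 with (2 := H).
  intros P HP. unfold within. revert HP. apply filter_imp. auto.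
Qed.

Lemma at_right_Ioc0 (a : R) : 0 < a -> at_right 0 (Ioc0 a).
Proof.
  intros Ha. apply (locally_Rabs _ _ _ Ha). intros y Hy Hy0.
  apply Rabs_def2 in Hy. unfold Ioc0. lra.
Qed.

(** The extension is the constant [l] to the left of 0 and the constant [h a] to the right of [a].
    The last conjunct lists all its values, so that an extension of a nonvanishing function with
    nonzero limit is nonzero everywhere and can be inverted globally. *)
Lemma continuous_extension (a : R) (h : R -> C) (l : C) :
  0 < a -> continuous_on (Ioc0 a) h -> filterlim h (at_right 0) (locally l) ->
  exists H : R -> C,
    (forall x, continuous H x) /\ (forall x, Ioc0 a x -> H x = h x) /\ H 0 = l /\
    (forall x, H x = l \/ exists y, Ioc0 a y /\ H x = h y).
Proof.
  intros Ha Hc Hl.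
  exists (fun x => if Rle_dec x 0 then l else h (Rmin x a)).
  split; [|split; [|split]].
  - intros x. destruct (Rtotal_order x 0) as [Hx|[Hx|Hx]].
    + apply (continuous_ext_loc _ (fun _ : R => l)).
      * assert (Hd : 0 < - x) by lra. apply (locally_Rabs _ _ _ Hd). intros y Hy.
        apply Rabs_def2 in Hy. destruct (Rle_dec y 0); [reflexivity | lra].
      * apply continuous_const.
    + subst x. unfold continuous. destruct (Rle_dec 0 0) as [_|]; [|lra].
      apply filterlim_Cmod; [apply locally_filter|]. intros eps He.
      pose proof (proj1 (filterlim_Cmod (at_right 0) h l) Hl eps He) as H1.
      generalize (filter_and _ _ H1 (at_right_Ioc0 a Ha)).
      unfold at_right, within. apply filter_imp. intros y K.
      destruct (Rle_dec y 0) as [_|Hy].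
      * replace (l - l)%C with (RtoC 0) by ring. now rewrite Cmod_0.
      * destruct (K ltac:(lra)) as [K1 K2]. unfold Ioc0 in K2.
        rewrite Rmin_left by lra. exact K1.
    + unfold continuous. destruct (Rle_dec x 0) as [|_]; [lra|].
      assert (HD : Ioc0 a (Rmin x a)).
      { split; [now apply Rmin_pos | apply Rmin_r]. }
      (* The clamp is nonexpansive and sends a neighbourhood of [x] into (0,a], so continuity
         relative to (0,a] is enough, even at [x = a]. *)
      assert (H1 : filterlim (fun y => h (Rmin y a)) (locally x) (locally (h (Rmin x a)))).
      { eapply filterlim_comp; [|exact (Hc _ HD)].
        intros P [d Hd]. unfold filtermap.
        assert (Hm : 0 < Rmin d x) by (apply Rmin_pos; [apply cond_pos | lra]).
        apply (locally_Rabs _ _ _ Hm). intros y Hy.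
        pose proof (Rmin_l d x). pose proof (Rmin_r d x).
        apply Hd.
        - change (Rabs (Rmin y a - Rmin x a) < d).
          eapply Rle_lt_trans; [|apply Rlt_le_trans with (1 := Hy); apply Rmin_l].
          unfold Rmin. destruct (Rle_dec y a), (Rle_dec x a); unfold Rabs;
            repeat destruct Rcase_abs; lra.
        - apply Rabs_def2 in Hy. split; [apply Rmin_pos; lra | apply Rmin_r]. }
      apply filterlim_ext_loc with (2 := H1).
      apply (locally_Rabs _ _ _ Hx). intros y Hy.
      apply Rabs_def2 in Hy. destruct (Rle_dec y 0); [lra | reflexivity].
  - intros x [H0 H1]. destruct (Rle_dec x 0); [lra|]. now rewrite Rmin_left.
  - destruct (Rle_dec 0 0); [reflexivity | lra].
  - intros x. destruct (Rle_dec x 0) as [|Hx]; [now left|]. right.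
    exists (Rmin x a). split; [|reflexivity].
    split; [apply Rmin_pos; lra | apply Rmin_r].
Qed.

Lemma continuous_extension_Icc0 (a : R) (h : R -> C) :
  0 < a -> continuous_on (Icc0 a) h ->
  exists H : R -> C,
    (forall x, continuous H x) /\ (forall x, Ioc0 a x -> H x = h x) /\ H 0 = h 0.
Proof.
  intros Ha Hc.
  destruct (continuous_extension a h (h 0) Ha) as (H & H1 & H2 & H3 & _).
  - apply continuous_on_subset with (2 := Hc). unfold Ioc0, Icc0. intros; lra.
  - apply (filterlim_within_at_right 0 a h (h 0) (Icc0 a) Ha).
    + unfold Icc0. intros; lra.
    + apply Hc. unfold Icc0. lra.
  - now exists H.
Qed.

Lemma continuous_bounded (a : R) (H : R -> C) :
  (forall x, continuous H x) ->
  exists M, 0 < M /\ forall x, 0 <= x <= a -> Cmod (H x) <= M.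
Proof.
  intros Hc.
  destruct (bounded_continuity (V := C_R_NormedModule) H 0 a) as [M HM].
  - intros x _. apply Hc.
  - exists (Rmax 1 M). split; [apply Rlt_le_trans with 1; [lra | apply Rmax_l]|].
    intros x Hx. apply Rle_trans with M; [|apply Rmax_r].
    left. rewrite Cmod_norm. exact (HM x Hx).
Qed.

(** * Weighted means *)

(* [ring] and [field] do not see through the module structures that [apply] leaves on [C]. *)
Ltac Ceq := match goal with |- @eq _ ?x ?y => change (@eq C x y) end.
Ltac Cring := Ceq; ring.

(** The module [C_R_NormedModule] has real scalars only, so the product with [c] is integrated
    through its real and imaginary parts. *)
Lemma is_RInt_Cmult_l (c : C) (h : R -> C) (b d : R) (I : C) :
  is_RInt (V := C_R_NormedModule) h b d I ->
  is_RInt (V := C_R_NormedModule) (fun t => c * h t)%C b d (c * I)%C.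
Proof.
  intros H.
  pose proof (is_RInt_fct_extend_fst (U := R_NormedModule) (V := R_NormedModule) h b d I H) as H1.
  pose proof (is_RInt_fct_extend_snd (U := R_NormedModule) (V := R_NormedModule) h b d I H) as H2.
  apply (is_RInt_fct_extend_pair (U := R_NormedModule) (V := R_NormedModule)).
  - exact (is_RInt_minus (V := R_NormedModule) _ _ b d _ _
      (is_RInt_scal (V := R_NormedModule) _ b d (fst c) _ H1)
      (is_RInt_scal (V := R_NormedModule) _ b d (snd c) _ H2)).
  - exact (is_RInt_plus (V := R_NormedModule) _ _ b d _ _
      (is_RInt_scal (V := R_NormedModule) _ b d (fst c) _ H2)
      (is_RInt_scal (V := R_NormedModule) _ b d (snd c) _ H1)).
Qed.

Lemma ex_CRInt_continuous (h : R -> C) (b d : R) :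
  (forall x, continuous h x) -> ex_CRInt h b d.
Proof.
  intros H. apply (ex_RInt_continuous (V := C_R_CompleteNormedModule)). intros z _. apply H.
Qed.

Lemma CRInt_correct (h : R -> C) (b d : R) :
  ex_CRInt h b d -> is_RInt (V := C_R_NormedModule) h b d (CRInt h b d).
Proof. exact (RInt_correct (V := C_R_CompleteNormedModule) h b d). Qed.

Lemma CRInt_unique (h : R -> C) (b d : R) (I : C) :
  is_RInt (V := C_R_NormedModule) h b d I -> CRInt h b d = I.
Proof. exact (is_RInt_unique (V := C_R_CompleteNormedModule) h b d I). Qed.

Lemma CRInt_bound (h : R -> C) (m : R -> R) (x V : R) :
  0 <= x -> ex_CRInt h 0 x -> (forall t, 0 <= t <= x -> Cmod (h t) <= m t) ->
  is_RInt m 0 x V -> Cmod (CRInt h 0 x) <= V.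
Proof.
  intros Hx He Hm HV. rewrite Cmod_norm.
  apply (norm_RInt_le (V := C_R_NormedModule) h m 0 x); auto.
  - intros t Ht. rewrite <- Cmod_norm. now apply Hm.
  - now apply CRInt_correct.
Qed.

Definition weight (P : R -> R) : Prop :=
  (forall x, continuous P x) /\ (forall x, 0 < x -> 0 < P x) /\
  (forall s t, 0 <= s -> s <= t -> 0 <= P s <= P t).

(** The quotient may read 0/0 at 0; the value 0 chosen there is its limit, and extending it to the
    left makes the mean continuous everywhere. *)
Definition wmean (P : R -> R) (w : R -> C) (x : R) : C :=
  if Rle_dec x 0 then RtoC 0
  else (RtoC (/ P x) * CRInt (fun t => RtoC (P t) * w t) 0 x)%C.

Lemma wmean_0 (P : R -> R) (w : R -> C) (x : R) : x <= 0 -> wmean P w x = RtoC 0.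
Proof. intros Hx. unfold wmean. now destruct (Rle_dec x 0). Qed.

Lemma continuous_weighted (P : R -> R) (w : R -> C) :
  weight P -> (forall x, continuous w x) ->
  forall x, continuous (fun t => RtoC (P t) * w t)%C x.
Proof.
  intros (HP & _) Hw x.
  apply (filterlim_Cmult (locally x)); [|apply Hw].
  apply (filterlim_RtoC (locally x)), HP.
Qed.

Lemma wmean_pos (P : R -> R) (w : R -> C) (x : R) :
  weight P -> 0 < x ->
  (RtoC (P x) * wmean P w x)%C = CRInt (fun t => RtoC (P t) * w t)%C 0 x.
Proof.
  intros (_ & HP & _) Hx. unfold wmean. destruct (Rle_dec x 0); [lra|].
  specialize (HP x Hx). rewrite Cmult_assoc, <- RtoC_mult, Rinv_r, Cmult_1_l by lra.
  reflexivity.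
Qed.

Lemma wmean_eq (P : R -> R) (w : R -> C) (x : R) (z : C) :
  weight P -> 0 < x ->
  is_RInt (V := C_R_NormedModule) (fun t => RtoC (P t) * w t)%C 0 x (RtoC (P x) * z)%C ->
  wmean P w x = z.
Proof.
  intros HP Hx H. apply CRInt_unique in H.
  unfold wmean. destruct (Rle_dec x 0); [lra|]. rewrite H.
  destruct HP as (_ & HP & _). specialize (HP x Hx).
  rewrite Cmult_assoc, <- RtoC_mult, Rinv_l, Cmult_1_l by lra. reflexivity.
Qed.

Lemma wmean_is_RInt (P : R -> R) (w : R -> C) (x : R) :
  weight P -> (forall t, continuous w t) -> 0 < x ->
  is_RInt (V := C_R_NormedModule) (fun t => RtoC (P t) * w t)%C 0 x
    (RtoC (P x) * wmean P w x)%C.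
Proof.
  intros HP Hw Hx. rewrite wmean_pos by assumption.
  apply CRInt_correct, ex_CRInt_continuous. now apply continuous_weighted.
Qed.

(** Under the integral P(t) <= P(x), and the factor P(x) cancels against the normalization: the
    estimate is that of the unweighted integral. *)
Lemma wmean_bound (P : R -> R) (w : R -> C) (m : R -> R) (x V : R) :
  weight P -> (forall t, continuous w t) -> 0 < x ->
  (forall t, 0 <= t <= x -> Cmod (w t) <= m t) ->
  is_RInt m 0 x V -> Cmod (wmean P w x) <= V.
Proof.
  intros HP Hw Hx Hm HV.
  pose proof (proj1 (proj2 HP) x Hx) as HPx.
  apply Rmult_le_reg_l with (P x); [exact HPx|].
  rewrite <- (Rabs_pos_eq (P x)) at 1 by lra.
  rewrite <- Cmod_R, <- Cmod_mult, wmean_pos by assumption.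
  apply CRInt_bound with (m := fun t => P x * m t).
  - lra.
  - apply ex_CRInt_continuous. now apply continuous_weighted.
  - intros t Ht. rewrite Cmod_mult, Cmod_R.
    destruct (proj2 (proj2 HP) t x ltac:(lra) ltac:(lra)) as [H1 H2].
    rewrite Rabs_pos_eq by exact H1.
    apply Rmult_le_compat; [exact H1 | apply Cmod_ge_0 | exact H2 | now apply Hm].
  - exact (is_RInt_scal (V := R_NormedModule) m 0 x (P x) V HV).
Qed.

Lemma wmean_bound_const (P : R -> R) (w : R -> C) (M x : R) :
  weight P -> (forall t, continuous w t) -> 0 <= x ->
  (forall t, 0 <= t <= x -> Cmod (w t) <= M) -> Cmod (wmean P w x) <= x * M.
Proof.
  intros HP Hw Hx HM. destruct (Req_dec x 0) as [->|Hx0].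
  { rewrite wmean_0, Cmod_0 by lra. lra. }
  apply wmean_bound with (m := fun _ => M); auto; [lra|].
  replace (x * M) with (scal (V := R_NormedModule) (x - 0) M).
  - apply (is_RInt_const (V := R_NormedModule)).
  - unfold scal; simpl; unfold mult; simpl. ring.
Qed.

Lemma wmean_plus (P : R -> R) (w1 w2 : R -> C) (x : R) :
  weight P -> (forall t, continuous w1 t) -> (forall t, continuous w2 t) ->
  wmean P (fun t => w1 t + w2 t)%C x = (wmean P w1 x + wmean P w2 x)%C.
Proof.
  intros HP H1 H2. destruct (Rle_dec x 0) as [Hx|Hx].
  - rewrite !wmean_0 by exact Hx. ring.
  - apply Rnot_le_lt in Hx. apply wmean_eq; [exact HP | exact Hx |].
    rewrite Cmult_plus_distr_l.
    apply (is_RInt_ext (V := C_R_NormedModule))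
      with (f := fun t => (RtoC (P t) * w1 t + RtoC (P t) * w2 t)%C).
    + intros t _. Cring.
    + apply (is_RInt_plus (V := C_R_NormedModule)); now apply wmean_is_RInt.
Qed.

Lemma wmean_scal (P : R -> R) (c : C) (w : R -> C) (x : R) :
  weight P -> (forall t, continuous w t) ->
  wmean P (fun t => c * w t)%C x = (c * wmean P w x)%C.
Proof.
  intros HP Hw. destruct (Rle_dec x 0) as [Hx|Hx].
  - rewrite !wmean_0 by exact Hx. ring.
  - apply Rnot_le_lt in Hx. apply wmean_eq; [exact HP | exact Hx |].
    replace (RtoC (P x) * (c * wmean P w x))%C with (c * (RtoC (P x) * wmean P w x))%C by ring.
    apply (is_RInt_ext (V := C_R_NormedModule))
      with (f := fun t => (c * (RtoC (P t) * w t))%C).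
    + intros t _. Cring.
    + apply is_RInt_Cmult_l. now apply wmean_is_RInt.
Qed.

Lemma wmean_ext (P : R -> R) (w1 w2 : R -> C) (x : R) :
  (forall t, 0 < t < x -> w1 t = w2 t) -> wmean P w1 x = wmean P w2 x.
Proof.
  intros H. unfold wmean. destruct (Rle_dec x 0) as [|Hx]; [reflexivity|].
  apply Rnot_le_lt in Hx. f_equal.
  apply (RInt_ext (V := C_R_CompleteNormedModule)). intros t Ht.
  rewrite Rmin_left, Rmax_right in Ht by lra. now rewrite H.
Qed.

Lemma continuous_CRInt (h : R -> C) (x : R) :
  (forall t, continuous h t) -> continuous (CRInt h 0) x.
Proof.
  intros H. apply (continuous_RInt_1 (V := C_R_NormedModule) h 0 x).
  apply filter_forall. intros z. now apply CRInt_correct, ex_CRInt_continuous.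
Qed.

(** For [x > 0] this is a quotient of continuous functions with nonzero denominator. At 0, where [P]
    may vanish, continuity comes from the bound of the mean by [y * M]. *)
Lemma continuous_wmean (P : R -> R) (w : R -> C) :
  weight P -> (forall t, continuous w t) -> forall x, continuous (wmean P w) x.
Proof.
  intros HP Hw x. destruct (Rtotal_order x 0) as [Hx|[Hx|Hx]].
  - apply (continuous_ext_loc _ (fun _ : R => RtoC 0)); [|apply continuous_const].
    assert (Hd : 0 < - x) by lra. apply (locally_Rabs _ _ _ Hd). intros y Hy.
    apply Rabs_def2 in Hy. symmetry. apply wmean_0. lra.
  - subst x. unfold continuous. rewrite wmean_0 by lra.
    apply filterlim_Cmod; [apply locally_filter|]. intros eps He.
    destruct (continuous_bounded 1 w Hw) as (M & HM0 & HM).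
    assert (Hq : 0 < eps / M) by now apply Rdiv_lt_0_compat.
    assert (Hd : 0 < Rmin 1 (eps / M)) by (apply Rmin_pos; lra).
    apply (locally_Rabs _ _ _ Hd). intros y Hy.
    replace (wmean P w y - 0)%C with (wmean P w y) by ring.
    destruct (Rle_dec y 0) as [Hy0|Hy0].
    + rewrite wmean_0, Cmod_0 by exact Hy0. exact He.
    + apply Rnot_le_lt in Hy0. apply Rabs_def2 in Hy.
      pose proof (Rmin_l 1 (eps / M)). pose proof (Rmin_r 1 (eps / M)).
      apply Rle_lt_trans with (y * M).
      * apply wmean_bound_const; auto; [lra|]. intros t Ht. apply HM. lra.
      * replace eps with (eps / M * M) by (field; lra).
        apply Rmult_lt_compat_r; lra.
  - pose proof (proj1 (proj2 HP) x Hx) as HPx.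
    apply (continuous_ext_loc _ (fun y => RtoC 1 / RtoC (P y) *
        CRInt (fun t => RtoC (P t) * w t) 0 y)%C).
    + apply (locally_Rabs _ _ _ Hx). intros y Hy. apply Rabs_def2 in Hy.
      unfold wmean. destruct (Rle_dec y 0); [lra|].
      pose proof (proj1 (proj2 HP) y ltac:(lra)).
      rewrite RtoC_inv by lra. unfold Cdiv. Cring.
    + apply (filterlim_Cmult (locally x)).
      * apply (filterlim_Cdiv (locally x)).
        -- intros E. apply RtoC_inj in E. lra.
        -- apply (filterlim_const (U := C_UniformSpace)).
        -- apply (filterlim_RtoC (locally x)), (proj1 HP).
      * apply continuous_CRInt. now apply continuous_weighted.
Qed.

Lemma is_derive_CRInt (h : R -> C) (x : R) :
  (forall t, continuous h t) ->
  is_derive (V := C_R_NormedModule) (CRInt h 0) x (h x).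
Proof.
  intros H. apply (is_derive_RInt (V := C_R_NormedModule) h (CRInt h 0) 0 x); [|apply H].
  apply filter_forall. intros z. now apply CRInt_correct, ex_CRInt_continuous.
Qed.

(** * Constant and power weights *)

Lemma weight_one : weight (fun _ => 1).
Proof.
  split; [|split].
  - intros x. apply continuous_const.
  - intros; lra.
  - intros; lra.
Qed.

(* [Rpower x k] is the junk value [1] at [x = 0]. *)
Definition pospow (k x : R) : R := if Rle_dec x 0 then 0 else Rpower x k.

Lemma pospow_pos (k x : R) : 0 < x -> pospow k x = Rpower x k.
Proof. intros Hx. unfold pospow. destruct (Rle_dec x 0); [lra | reflexivity]. Qed.

Lemma Rpower_gt_0 (x k : R) : 0 < Rpower x k.
Proof. apply exp_pos. Qed.

Lemma is_derive_Rpower (x k : R) :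
  0 < x -> is_derive (fun t => Rpower t k) x (k * Rpower x (k - 1)).
Proof. intros Hx. apply is_derive_Reals. now apply derivable_pt_lim_power. Qed.

Lemma Rpower_small (k eps : R) :
  0 < k -> 0 < eps -> exists d, 0 < d /\ forall x, 0 < x < d -> Rpower x k < eps.
Proof.
  intros Hk He. exists (Rpower eps (/ k)). split; [apply Rpower_gt_0|].
  intros x Hx. replace eps with (Rpower (Rpower eps (/ k)) k).
  - apply Rlt_Rpower_l; lra.
  - rewrite Rpower_mult, Rinv_l, Rpower_1; lra.
Qed.

Lemma continuous_pospow (k x : R) : 0 < k -> continuous (pospow k) x.
Proof.
  intros Hk. destruct (Rtotal_order x 0) as [Hx|[Hx|Hx]].
  - apply (continuous_ext_loc _ (fun _ : R => 0)); [|apply continuous_const].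
    assert (Hd : 0 < - x) by lra. apply (locally_Rabs _ _ _ Hd). intros y Hy.
    apply Rabs_def2 in Hy. unfold pospow. destruct (Rle_dec y 0); [reflexivity | lra].
  - subst x. apply filterlim_locally. intros eps.
    destruct (Rpower_small k eps Hk (cond_pos eps)) as (d & Hd & H).
    apply (locally_Rabs _ _ _ Hd). intros y Hy. apply Rabs_def2 in Hy.
    change (Rabs (pospow k y - pospow k 0) < eps). unfold pospow.
    destruct (Rle_dec 0 0); [|lra]. destruct (Rle_dec y 0) as [|Hy0].
    + rewrite Rminus_diag, Rabs_R0. apply cond_pos.
    + rewrite Rminus_0_r, Rabs_pos_eq by (left; apply Rpower_gt_0). apply H. lra.
  - apply (continuous_ext_loc _ (fun t => Rpower t k)).
    + apply (locally_Rabs _ _ _ Hx). intros y Hy. apply Rabs_def2 in Hy.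
      symmetry. apply pospow_pos. lra.
    + apply (ex_derive_continuous (V := R_NormedModule)).
      eexists. now apply is_derive_Rpower.
Qed.

Lemma weight_pospow (k : R) : 0 < k -> weight (pospow k).
Proof.
  intros Hk. split; [|split].
  - intros x. now apply continuous_pospow.
  - intros x Hx. rewrite pospow_pos by exact Hx. apply Rpower_gt_0.
  - intros s t Hs Hst. unfold pospow.
    destruct (Rle_dec s 0), (Rle_dec t 0); try lra.
    + split; [lra | left; apply Rpower_gt_0].
    + split; [left; apply Rpower_gt_0 | apply Rle_Rpower_l; lra].
Qed.

(** Fundamental theorem of calculus with antiderivative x^(k+1) / (k+1). It asks for a two-sided
    derivative at the endpoint 0: there the difference quotient is 0 on the left and h^k / (k+1) on
    the right. The result is factored by [pospow k x] to match [wmean_eq]. *)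
Lemma is_RInt_pospow (k x : R) :
  0 < k -> 0 < x -> is_RInt (pospow k) 0 x (pospow k x * (x / (k + 1))).
Proof.
  intros Hk Hx.
  replace (pospow k x * (x / (k + 1)))
    with (minus (pospow (k + 1) x / (k + 1)) (pospow (k + 1) 0 / (k + 1))).
  2:{ rewrite (pospow_pos (k + 1) x Hx), (pospow_pos k x Hx). unfold pospow. destruct (Rle_dec 0 0); [|lra].
      rewrite Rpower_plus, Rpower_1 by exact Hx.
      unfold minus, plus, opp; simpl. field. lra. }
  apply (is_RInt_derive (V := R_CompleteNormedModule)
    (fun t => pospow (k + 1) t / (k + 1)) (pospow k)).
  2:{ intros t _. now apply continuous_pospow. }
  intros t Ht. rewrite Rmin_left, Rmax_right in Ht by lra.
  destruct (Req_dec t 0) as [Ht0|Ht0].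
  - subst t. apply is_derive_Reals. intros eps He.
    destruct (Rpower_small k eps Hk He) as (d & Hd & H).
    exists (mkposreal d Hd). intros h Hh0 Hh. simpl in Hh.
    unfold pospow. destruct (Rle_dec 0 0); [|lra]. rewrite Rplus_0_l.
    destruct (Rle_dec h 0) as [Hn|Hp].
    + replace ((0 / (k + 1) - 0 / (k + 1)) / h - 0) with 0 by (unfold Rdiv; ring). now rewrite Rabs_R0.
    + apply Rnot_le_lt in Hp. rewrite Rabs_pos_eq in Hh by lra.
      rewrite Rpower_plus, Rpower_1 by exact Hp.
      replace ((Rpower h k * h / (k + 1) - 0 / (k + 1)) / h - 0)
        with (Rpower h k / (k + 1)) by (field; lra).
      pose proof (Rpower_gt_0 h k).
      rewrite Rabs_pos_eq by (left; apply Rdiv_lt_0_compat; lra).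
      apply Rle_lt_trans with (Rpower h k); [|apply H; lra].
      apply Rmult_le_reg_r with (k + 1); [lra|].
      unfold Rdiv. rewrite Rmult_assoc, Rinv_l by lra. nra.
  - assert (Htp : 0 < t) by lra.
    apply is_derive_ext_loc with (fun y => Rpower y (k + 1) / (k + 1)).
    + apply (locally_Rabs _ _ _ Htp). intros y Hy. apply Rabs_def2 in Hy.
      rewrite pospow_pos by lra. reflexivity.
    + rewrite pospow_pos by exact Htp.
      replace (Rpower t k) with (/ (k + 1) * ((k + 1) * Rpower t (k + 1 - 1))).
      2:{ replace (k + 1 - 1) with k by ring. field. lra. }
      apply is_derive_ext with (fun y => / (k + 1) * Rpower y (k + 1)).
      { intros y. apply Rmult_comm. }
      apply is_derive_scal. now apply is_derive_Rpower.
Qed.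

Lemma wmean_pospow_const (k x : R) (c : C) :
  0 < k -> 0 < x -> wmean (pospow k) (fun _ => c) x = (c * RtoC (x / (k + 1)))%C.
Proof.
  intros Hk Hx. apply wmean_eq; [now apply weight_pospow | exact Hx |].
  replace (RtoC (pospow k x) * (c * RtoC (x / (k + 1))))%C
    with (c * RtoC (pospow k x * (x / (k + 1))))%C by (rewrite RtoC_mult; ring).
  apply (is_RInt_ext (V := C_R_NormedModule)) with (f := fun t => (c * RtoC (pospow k t))%C).
  { intros t _. Cring. }
  apply is_RInt_Cmult_l.
  apply (is_RInt_fct_extend_pair (U := R_NormedModule) (V := R_NormedModule)).
  - simpl. now apply is_RInt_pospow.
  - pose proof (is_RInt_const (V := R_NormedModule) 0 x zero) as Hz.
    now rewrite (scal_zero_r (V := R_NormedModule)) in Hz.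
Qed.

(** Freeze [w] at [w 0]: the mean of a constant is exactly x / (k+1) times it, and the mean of the
    difference is at most x times its supremum on [0,x], hence o(x). With k = 2 kappa this produces
    the denominator 2 kappa + 1 in the limit of om(x) / x. *)
Lemma filterlim_wmean_pospow (k : R) (w : R -> C) :
  0 < k -> (forall t, continuous w t) ->
  filterlim (fun x => wmean (pospow k) w x / RtoC x)%C (at_right 0)
    (locally (w 0 / RtoC (k + 1))%C).
Proof.
  intros Hk Hw. apply filterlim_Cmod; [apply at_right_proper_filter|]. intros eps He.
  assert (He2 : 0 < eps / 2) by lra.
  pose proof (proj1 (filterlim_Cmod (locally 0) w (w 0)) (Hw 0) _ He2) as [d Hd].
  generalize (at_right_Ioc0 (d / 2) ltac:(pose proof (cond_pos d); lra)).
  apply filter_imp. intros x [Hx Hxd].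
  assert (HxC : RtoC x <> RtoC 0) by (intros E; apply RtoC_inj in E; lra).
  assert (HkC : RtoC (k + 1) <> RtoC 0) by (intros E; apply RtoC_inj in E; lra).
  replace (wmean (pospow k) w x / RtoC x - w 0 / RtoC (k + 1))%C
    with (wmean (pospow k) (fun t => w t + - w 0)%C x / RtoC x)%C.
  - rewrite Cmod_div by exact HxC. rewrite Cmod_R, (Rabs_pos_eq x) by lra.
    apply Rle_lt_trans with (x * (eps / 2) / x).
    + apply Rmult_le_compat_r; [left; now apply Rinv_0_lt_compat|].
      apply wmean_bound_const; [now apply weight_pospow | | lra |].
      * intros t. apply (filterlim_Cplus (locally t)); [apply Hw|].
        apply (filterlim_const (U := C_UniformSpace)).
      * intros t Ht. left. apply (Hd t). change (Rabs (t - 0) < d).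
        pose proof (cond_pos d). rewrite Rminus_0_r, Rabs_pos_eq; lra.
    + replace (x * (eps / 2) / x) with (eps / 2) by (field; lra). lra.
  - rewrite wmean_plus; [| now apply weight_pospow | exact Hw |].
    + rewrite wmean_pospow_const by assumption. unfold Rdiv.
      rewrite RtoC_mult, RtoC_inv by lra. field. split; assumption.
    + intros t. apply (filterlim_const (U := C_UniformSpace)).
Qed.

(** * Uniformly convergent series *)

Definition unif_series (a : R) (w : nat -> R -> C) (s : R -> C) : Prop :=
  forall eps, 0 < eps ->
  eventually (fun N => forall t, 0 <= t <= a ->
    Cmod (sum_n (fun n => w n t) N - s t) <= eps).

Lemma is_series_Cunique (u : nat -> C) (l m : C) : is_series u l -> is_series u m -> l = m.
Proof. exact (filterlim_Cunique eventually _ l m). Qed.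

Lemma sum_n_Cplus (u v : nat -> C) (N : nat) :
  sum_n (fun n => u n + v n)%C N = (sum_n u N + sum_n v N)%C.
Proof. exact (sum_n_plus (G := C_AbelianMonoid) u v N). Qed.

Lemma sum_n_Cmult_l (c : C) (u : nat -> C) (N : nat) :
  sum_n (fun n => c * u n)%C N = (c * sum_n u N)%C.
Proof. exact (sum_n_mult_l (K := C_Ring) c u N). Qed.

Lemma sum_n_m_Cminus (u : nat -> C) (m N : nat) :
  (m <= N)%nat -> sum_n_m u (S m) N = (sum_n u N - sum_n u m)%C.
Proof. exact (sum_n_m_sum_n (G := C_AbelianGroup) u m N). Qed.

Lemma sum_n_CS (u : nat -> C) (N : nat) : sum_n u (S N) = (sum_n u N + u (S N))%C.
Proof. exact (sum_Sn (G := C_AbelianMonoid) u N). Qed.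

Lemma continuous_sum_n (w : nat -> R -> C) (N : nat) (x : R) :
  (forall n, continuous (w n) x) -> continuous (fun t => sum_n (fun n => w n t) N) x.
Proof.
  intros H. induction N as [|N IH].
  - apply continuous_ext with (w 0%nat); [|apply H].
    intros t. now rewrite sum_O.
  - apply continuous_ext with (fun t => sum_n (fun n => w n t) N + w (S N) t)%C.
    + intros t. now rewrite sum_n_CS.
    + apply (filterlim_Cplus (locally x)); [exact IH | apply H].
Qed.

Lemma unif_series_is_series (a : R) (w : nat -> R -> C) (s : R -> C) (t : R) :
  unif_series a w s -> 0 <= t <= a -> is_series (fun n => w n t) (s t).
Proof.
  intros H Ht. apply (filterlim_Cmod eventually). intros eps He.
  generalize (H (eps / 2) ltac:(lra)). apply filter_imp. intros N HN.
  eapply Rle_lt_trans; [apply HN, Ht | lra].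
Qed.

Lemma unif_series_plus (a : R) (w1 w2 : nat -> R -> C) (s1 s2 : R -> C) :
  unif_series a w1 s1 -> unif_series a w2 s2 ->
  unif_series a (fun n t => w1 n t + w2 n t)%C (fun t => s1 t + s2 t)%C.
Proof.
  intros H1 H2 eps He.
  generalize (filter_and (F := eventually) _ _ (H1 (eps / 2) ltac:(lra)) (H2 (eps / 2) ltac:(lra))).
  apply filter_imp. intros N [K1 K2] t Ht. specialize (K1 t Ht). specialize (K2 t Ht).
  replace (sum_n (fun n => w1 n t + w2 n t)%C N - (s1 t + s2 t))%C
    with ((sum_n (fun n => w1 n t) N - s1 t) + (sum_n (fun n => w2 n t) N - s2 t))%C.
  - eapply Rle_trans; [apply Cmod_triangle | lra].
  - rewrite sum_n_Cplus. ring.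
Qed.

Lemma unif_series_mult (a : R) (c : R -> C) (w : nat -> R -> C) (s : R -> C) :
  (forall t, continuous c t) -> unif_series a w s ->
  unif_series a (fun n t => c t * w n t)%C (fun t => c t * s t)%C.
Proof.
  intros Hc H eps He. destruct (continuous_bounded a c Hc) as (M & HM0 & HM).
  assert (Hq : 0 < eps / M) by now apply Rdiv_lt_0_compat.
  generalize (H _ Hq). apply filter_imp. intros N K t Ht. specialize (K t Ht).
  replace (sum_n (fun n => c t * w n t)%C N - c t * s t)%C
    with (c t * (sum_n (fun n => w n t) N - s t))%C.
  - rewrite Cmod_mult. apply Rle_trans with (M * (eps / M)); [|right; field; lra].
    apply Rmult_le_compat; [apply Cmod_ge_0 | apply Cmod_ge_0 | now apply HM | exact K].
  - rewrite sum_n_Cmult_l. ring.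
Qed.

(** The recursion expresses the term of index [S n] through that of index [n], so summing it
    requires the series without its head. *)
Lemma unif_series_shift (a : R) (w : nat -> R -> C) (s : R -> C) :
  unif_series a w s -> unif_series a (fun n => w (S n)) (fun t => s t - w 0%nat t)%C.
Proof.
  intros H eps He. destruct (H eps He) as [N0 HN]. exists N0. intros N HN0 t Ht.
  specialize (HN (S N) ltac:(lia) t Ht).
  replace (sum_n (fun n => w (S n) t) N - (s t - w 0%nat t))%C
    with (sum_n (fun n => w n t) (S N) - s t)%C; [exact HN|].
  assert (E : forall n, sum_n (fun n => w n t) (S n)
              = (sum_n (fun n => w (S n) t) n + w 0%nat t)%C).
  { intros n. induction n as [|n IH].
    - rewrite sum_n_CS, !sum_O. apply Cplus_comm.
    - rewrite sum_n_CS, IH, sum_n_CS. Cring. }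
  rewrite E. ring.
Qed.

Lemma wmean_series (P : R -> R) (a x : R) (w : nat -> R -> C) (s : R -> C) :
  weight P -> (forall n t, continuous (w n) t) -> (forall t, continuous s t) ->
  unif_series a w s -> 0 <= x <= a ->
  is_series (fun n => wmean P (w n) x) (wmean P s x).
Proof.
  intros HP Hw Hs H Hx. apply (filterlim_Cmod eventually). intros eps He.
  (* A uniform error e in the partial sums costs at most x e in the mean; x + 1 replaces x so that x
     = 0 is covered. *)
  assert (Hq : 0 < eps / (x + 1)) by (apply Rdiv_lt_0_compat; lra).
  generalize (H _ Hq). apply filter_imp. intros N K.
  assert (E : forall n, sum_n (fun n => wmean P (w n) x) n
              = wmean P (fun t => sum_n (fun n => w n t) n) x).
  { intros n. induction n as [|n IH].
    - rewrite sum_O. apply wmean_ext. intros t _. now rewrite sum_O.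
    - rewrite sum_n_CS, IH. symmetry.
      rewrite (wmean_ext P _ (fun t => sum_n (fun n => w n t) n + w (S n) t)%C).
      + apply wmean_plus; [exact HP | | apply Hw].
        intros t. apply continuous_sum_n. intros m. apply Hw.
      + intros t _. now rewrite sum_n_CS. }
  rewrite E.
  assert (Hm : forall t, continuous (fun t => - (1) * s t)%C t).
  { intros t. apply (filterlim_Cmult (locally t)); [|apply Hs].
    apply (filterlim_const (U := C_UniformSpace)). }
  assert (HS : forall t, continuous (fun t => sum_n (fun n => w n t) N) t).
  { intros t. apply continuous_sum_n. intros n. apply Hw. }
  replace (wmean P (fun t => sum_n (fun n => w n t) N) x - wmean P s x)%C
    with (wmean P (fun t => sum_n (fun n => w n t) N + - (1) * s t)%C x).
  - apply Rle_lt_trans with (x * (eps / (x + 1))).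
    + apply wmean_bound_const; [exact HP | | lra |].
      * intros t. apply (filterlim_Cplus (locally t)); [apply HS | apply Hm].
      * intros t Ht.
        replace (sum_n (fun n => w n t) N + - (1) * s t)%C
          with (sum_n (fun n => w n t) N - s t)%C by Cring.
        apply K. lra.
    + apply Rlt_le_trans with ((x + 1) * (eps / (x + 1))).
      * apply Rmult_lt_compat_r; lra.
      * right. field. lra.
  - rewrite wmean_plus, wmean_scal by assumption. Cring.
Qed.

(** Composing with the clamp [cl] onto [0,a] turns uniform convergence on [0,a] into uniform
    convergence on the line, that is, convergence in the complete space of functions on R. The limit
    is then continuous everywhere. *)
Lemma weierstrass_M_test (a : R) (w : nat -> R -> C) (b : nat -> R) :
  0 < a -> (forall n t, continuous (w n) t) ->
  (forall n t, 0 <= t <= a -> Cmod (w n t) <= b n) -> ex_series b ->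
  exists s : R -> C, (forall t, continuous s t) /\ unif_series a w s.
Proof.
  intros Ha Hw Hb Hs.
  set (cl := fun t => Rmax 0 (Rmin t a)).
  assert (Hcl : forall t, 0 <= cl t <= a).
  { intros t. unfold cl. split; [apply Rmax_l|].
    apply Rmax_lub; [lra | apply Rmin_r]. }
  assert (Hcl_id : forall t, 0 <= t <= a -> cl t = t).
  { intros t Ht. unfold cl. rewrite Rmin_left, Rmax_right; lra. }
  assert (Hcl_c : forall t, continuous cl t).
  { intros t. apply filterlim_locally. intros eps. exists eps. intros y Hy.
    change (Rabs (y - t) < eps) in Hy. change (Rabs (cl y - cl t) < eps).
    eapply Rle_lt_trans; [|exact Hy]. unfold cl, Rmax, Rmin.
    repeat destruct Rle_dec; unfold Rabs; repeat destruct Rcase_abs; lra. }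
  set (S_ := fun (N : nat) (t : R) => sum_n (fun n => w n (cl t)) N).
  assert (HSc : forall N t, continuous (S_ N) t).
  { intros N t. apply continuous_sum_n. intros n.
    apply (continuous_comp cl (w n)); [apply Hcl_c | apply Hw]. }
  assert (HC : exists s : fct_UniformSpace R (CompleteNormedModule.CompleteSpace _ C_R_CompleteNormedModule),
             filterlim S_ eventually (locally s)).
  { apply (filterlim_locally_cauchy (U := @fct_CompleteSpace R (CompleteNormedModule.CompleteSpace _ C_R_CompleteNormedModule))
             (F := eventually) S_).
    intros eps.
    destruct (Cauchy_ex_series (V := R_CompleteNormedModule) b Hs eps) as [N HN].
    assert (Hlt : forall u v, (N <= u)%nat -> (u < v)%nat ->
              forall t, Cmod (S_ v t - S_ u t) < eps).
    { intros u v Hu Huv t. unfold S_.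
      rewrite <- (sum_n_m_Cminus (fun n => w n (cl t)) u v ltac:(lia)).
      eapply Rle_lt_trans with (sum_n_m b (S u) v).
      - rewrite Cmod_norm.
        eapply Rle_trans; [apply (norm_sum_n_m (V := C_R_NormedModule))|].
        apply sum_n_m_le. intros k. rewrite <- Cmod_norm. now apply Hb.
      - eapply Rle_lt_trans; [apply Rle_abs|]. apply HN; lia. }
    exists (fun n => (N <= n)%nat). split; [now exists N|].
    intros u v Hu Hv t. apply (norm_compat1 (V := C_R_NormedModule)).
    change (norm (V := C_R_NormedModule) (S_ v t - S_ u t)%C < eps).
    rewrite <- Cmod_norm.
    destruct (Nat.lt_total u v) as [Huv|[Huv|Huv]].
    - now apply Hlt.
    - subst v. replace (S_ u t - S_ u t)%C with (RtoC 0) by ring.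
      rewrite Cmod_0. apply cond_pos.
    - replace (S_ v t - S_ u t)%C with (- (S_ u t - S_ v t))%C by ring.
      rewrite Cmod_opp. now apply Hlt. }
  destruct HC as [s HC]. exists s. split.
  - intros x.
    (* Exchange of the limits N to infinity and y to x, valid because convergence is uniform; the
       iterated limit is identified with [s x] by uniqueness. *)
    destruct (filterlim_switch (U := (CompleteNormedModule.CompleteSpace _ C_R_CompleteNormedModule)) eventually _ (locally x) _ S_ s
                (fun N => S_ N x) HC (fun N => HSc N x)) as (l & H1 & H2).
    assert (H3 : filterlim (fun N => S_ N x) eventually (locally (s x))).
    { apply filterlim_locally. intros eps.
      generalize (proj1 (filterlim_locally S_ s) HC eps). apply filter_imp.
      intros N HN. apply HN. }
    unfold continuous. now rewrite (filterlim_Cunique eventually _ _ _ H3 H1).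
  - intros eps He.
    (* Balls of the uniform space and balls of the norm agree only up to [norm_factor]. *)
    assert (Hq : 0 < eps / norm_factor (V := C_R_NormedModule)).
    { apply Rdiv_lt_0_compat; [exact He | apply norm_factor_gt_0]. }
    generalize (proj1 (filterlim_locally S_ s) HC (mkposreal _ Hq)). apply filter_imp.
    intros N HN t Ht. specialize (HN t).
    apply (norm_compat2 (V := C_R_NormedModule)) in HN. left.
    change (norm (V := C_R_NormedModule) (S_ N t - s t)%C
      < norm_factor (V := C_R_NormedModule) * (eps / norm_factor (V := C_R_NormedModule))) in HN.
    rewrite <- Cmod_norm in HN. unfold S_ in HN. rewrite Hcl_id in HN by exact Ht.
    replace eps with (norm_factor (V := C_R_NormedModule)
      * (eps / norm_factor (V := C_R_NormedModule))).
    + exact HN.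
    + field. apply Rgt_not_eq, norm_factor_gt_0.
Qed.

(** * The Volterra system *)

(** The pairs are (xi_n, z_n), with n! removed. Note the shift: Z^(n) equals n! P z_(n+1), so the
    coefficient [cE], which comes from p2, multiplies the new [z'], while [cC] and [cD] multiply the
    old pair. It also makes z_0 = 0, in agreement with Y^(0) = g. *)
Fixpoint volterra (P : R -> R) (cA cB cC cD cE : R -> C) (n : nat) : (R -> C) * (R -> C) :=
  match n with
  | O => (fun _ => RtoC 1, fun _ => RtoC 0)
  | S m =>
      let xi := fst (volterra P cA cB cC cD cE m) in
      let z := snd (volterra P cA cB cC cD cE m) in
      let z' := wmean P (fun t => cA t * xi t + cB t * z t)%C in
      (wmean (fun _ => 1) (fun t => cC t * xi t + cD t * z t + cE t * z' t)%C, z')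
  end.

Lemma continuous_Cplus (h k : R -> C) :
  (forall t, continuous h t) -> (forall t, continuous k t) ->
  forall t, continuous (fun t => h t + k t)%C t.
Proof. intros H1 H2 t. apply (filterlim_Cplus (locally t)); [apply H1 | apply H2]. Qed.

Lemma continuous_Cmult (h k : R -> C) :
  (forall t, continuous h t) -> (forall t, continuous k t) ->
  forall t, continuous (fun t => h t * k t)%C t.
Proof. intros H1 H2 t. apply (filterlim_Cmult (locally t)); [apply H1 | apply H2]. Qed.

Lemma continuous_Cconst (c : C) : forall t : R, continuous (fun _ => c) t.
Proof. intros t. apply continuous_const. Qed.

Ltac cont := cbv beta; repeat match goal with
  | |- forall t, continuous (fun y => Cplus (@?h y) (@?k y)) t => apply (continuous_Cplus h k)
  | |- forall t, continuous (fun y => Cmult (@?h y) (@?k y)) t => apply (continuous_Cmult h k)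
  | |- forall t, continuous (fun _ => ?c) t => apply (continuous_Cconst c)
  | H : ?G |- ?G => exact H
  | H : forall t, continuous ?h t |- forall t, continuous (fun y => ?h y) t => exact H
  | H : forall n t, continuous (?h n) t |- forall t, continuous (?h ?n) t => exact (H n)
  | H : forall n t, continuous (?h n) t |- forall t, continuous (fun y => ?h ?n y) t => exact (H n)
  end.

Lemma continuous_volterra (P : R -> R) (cA cB cC cD cE : R -> C) (n : nat) :
  weight P ->
  (forall t, continuous cA t) -> (forall t, continuous cB t) ->
  (forall t, continuous cC t) -> (forall t, continuous cD t) ->
  (forall t, continuous cE t) ->
  (forall t, continuous (fst (volterra P cA cB cC cD cE n)) t) /\
  (forall t, continuous (snd (volterra P cA cB cC cD cE n)) t).
Proof.
  intros HP HA HB HC HD HE. induction n as [|n [IH1 IH2]]; simpl.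
  - split; apply continuous_Cconst.
  - assert (H : forall t, continuous (wmean P (fun t =>
        cA t * fst (volterra P cA cB cC cD cE n) t +
        cB t * snd (volterra P cA cB cC cD cE n) t)%C) t)
      by (apply continuous_wmean; cont).
    split; [|exact H]. apply continuous_wmean; [apply weight_one | cont].
Qed.

Lemma is_RInt_majorant (c L : R) (n : nat) (x : R) :
  is_RInt (fun t => c * (L ^ n * (t ^ n / INR (fact n)))) 0 x
    (c * (L ^ n * (x ^ S n / INR (fact (S n))))).
Proof.
  pose proof (INR_fact_lt_0 n) as Hf.
  assert (HS : INR (S n) <> 0) by (apply not_0_INR; lia).
  pose proof (is_RInt_scal (V := R_NormedModule) _ 0 x (c * L ^ n / INR (fact n)) _
                (is_RInt_pow 0 x n)) as H.
  replace (c * (L ^ n * (x ^ S n / INR (fact (S n)))))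
    with (scal (V := R_NormedModule) (c * L ^ n / INR (fact n))
            (x ^ S n / INR (S n) - 0 ^ S n / INR (S n))).
  - apply (is_RInt_ext (V := R_NormedModule)) with (2 := H).
    intros t _. unfold scal; simpl; unfold mult; simpl. field. lra.
  - rewrite pow_ne_zero by lia. rewrite fact_simpl, mult_INR.
    unfold scal; simpl; unfold mult; simpl. field. split; [lra | exact HS].
Qed.

(* The sequence is majorized by [(L x)^n / n!] with [L = 2K(1 + Ka)]. Besides this, the
   second component gains a factor [2Ka] over the previous step, which is what bounds the
   contribution of the coefficient [cE] without integrating twice. *)
Lemma volterra_bound (P : R -> R) (cA cB cC cD cE : R -> C) (a K : R) (n : nat) (x : R) :
  weight P -> 0 < a -> 0 < K ->
  (forall t, continuous cA t) -> (forall t, continuous cB t) ->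
  (forall t, continuous cC t) -> (forall t, continuous cD t) ->
  (forall t, continuous cE t) ->
  (forall t, 0 <= t <= a -> Cmod (cA t) <= K) ->
  (forall t, 0 <= t <= a -> Cmod (cB t) <= K) ->
  (forall t, 0 <= t <= a -> Cmod (cC t) <= K) ->
  (forall t, 0 <= t <= a -> Cmod (cD t) <= K) ->
  (forall t, 0 <= t <= a -> Cmod (cE t) <= K) ->
  0 <= x <= a ->
  let M := (2 * K * (1 + K * a)) ^ n * (x ^ n / INR (fact n)) in
  Cmod (fst (volterra P cA cB cC cD cE n) x) <= M /\
  Cmod (snd (volterra P cA cB cC cD cE n) x) <= M.
Proof.
  intros HP Ha HK HA HB HC HD HE KA KB KC KD KE.
  set (L := 2 * K * (1 + K * a)).
  assert (HKa : 0 < K * a) by now apply Rmult_lt_0_compat.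
  assert (HL : 0 < L) by (apply Rmult_lt_0_compat; lra).
  assert (HL2 : 2 * K <= L) by (unfold L; nra).
  assert (HM0 : forall m y, 0 <= y -> 0 <= L ^ m * (y ^ m / INR (fact m))).
  { intros m y Hy. pose proof (INR_fact_lt_0 m).
    apply Rmult_le_pos; [apply pow_le; lra|].
    apply Rmult_le_pos; [now apply pow_le | left; now apply Rinv_0_lt_compat]. }
  revert x. induction n as [|n IH]; intros x Hx.
  - simpl. rewrite Cmod_1, Cmod_0. unfold Rdiv. rewrite Rinv_1. lra.
  - simpl fst. simpl snd.
    set (xi := fst (volterra P cA cB cC cD cE n)) in *.
    set (z := snd (volterra P cA cB cC cD cE n)) in *.
    set (w := fun t => (cA t * xi t + cB t * z t)%C).
    destruct (continuous_volterra P cA cB cC cD cE n HP HA HB HC HD HE) as [Cxi Cz].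
    fold xi in Cxi. fold z in Cz.
    assert (Cw : forall t, continuous w t) by (unfold w; cont).
    assert (Cw' : forall t, continuous (wmean P w) t) by now apply continuous_wmean.
    set (M := fun m t => L ^ m * (t ^ m / INR (fact m))) in *.
    assert (Hw : forall t, 0 <= t <= a -> Cmod (w t) <= 2 * K * M n t).
    { intros t Ht. destruct (IH t Ht) as [I1 I2]. unfold w.
      eapply Rle_trans; [apply Cmod_triangle|]. rewrite !Cmod_mult.
      pose proof (Rmult_le_compat _ _ _ _ (Cmod_ge_0 _) (Cmod_ge_0 _) (KA t Ht) I1).
      pose proof (Rmult_le_compat _ _ _ _ (Cmod_ge_0 _) (Cmod_ge_0 _) (KB t Ht) I2).
      fold (M n t) in *. lra. }
    assert (Hmono : forall s t, 0 <= s <= t -> M n s <= M n t).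
    { intros s t Hst. unfold M. apply Rmult_le_compat_l; [apply pow_le; lra|].
      apply Rmult_le_compat_r; [left; apply Rinv_0_lt_compat, INR_fact_lt_0|].
      now apply pow_incr. }
    assert (Hz : forall t, 0 <= t <= a -> Cmod (wmean P w t) <= 2 * (K * a) * M n t).
    { intros t Ht. apply Rle_trans with (t * (2 * K * M n t)).
      - apply wmean_bound_const; [exact HP | exact Cw | lra |].
        intros s Hs. eapply Rle_trans; [apply Hw; lra|].
        apply Rmult_le_compat_l; [lra | now apply Hmono].
      - pose proof (HM0 n t ltac:(lra)) as H0. fold (M n t) in H0.
        replace (2 * (K * a) * M n t) with (a * (2 * K * M n t)) by ring.
        apply Rmult_le_compat_r; [|lra]. apply Rmult_le_pos; [lra | exact H0]. }
    (* The next majorant is [L] times the integral of the current one, so it is enough to reach a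
       factor [c <= L] in front of that integral. *)
    assert (HMS : forall c, c * (L ^ n * (x ^ S n / INR (fact (S n))))
              <= M (S n) x + (c - L) * (L ^ n * (x ^ S n / INR (fact (S n))))).
    { intros c. right. unfold M. simpl pow. ring. }
    assert (HQ : 0 <= L ^ n * (x ^ S n / INR (fact (S n)))).
    { apply Rmult_le_pos; [apply pow_le; lra|].
      apply Rmult_le_pos; [apply pow_le; lra|].
      left; apply Rinv_0_lt_compat, INR_fact_lt_0. }
    destruct (Req_dec x 0) as [Hx0|Hx0].
    { rewrite !wmean_0, Cmod_0 by lra. fold (M (S n) x).
      pose proof (HM0 (S n) x ltac:(lra)). split; assumption. }
    fold (M (S n) x). split.
    (* The integrand is at most (K + K + K * 2Ka) M n, and this sum is exactly [L]. *)
    + apply Rle_trans with (L * (L ^ n * (x ^ S n / INR (fact (S n))))).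
      * apply wmean_bound with (m := fun t => L * M n t);
          [apply weight_one | cont | lra | | apply is_RInt_majorant].
        intros t Ht. assert (Hta : 0 <= t <= a) by lra.
        destruct (IH t Hta) as [I1 I2].
        eapply Rle_trans; [apply Cmod_triangle|].
        eapply Rle_trans; [apply Rplus_le_compat_r, Cmod_triangle|]. rewrite !Cmod_mult.
        pose proof (Rmult_le_compat _ _ _ _ (Cmod_ge_0 _) (Cmod_ge_0 _) (KC t Hta) I1).
        pose proof (Rmult_le_compat _ _ _ _ (Cmod_ge_0 _) (Cmod_ge_0 _) (KD t Hta) I2).
        pose proof (Rmult_le_compat _ _ _ _ (Cmod_ge_0 _) (Cmod_ge_0 _) (KE t Hta) (Hz t Hta)).
        fold (M n t) in *. unfold L at 1. lra.
      * pose proof (HMS L). lra.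
    + apply Rle_trans with (2 * K * (L ^ n * (x ^ S n / INR (fact (S n))))).
      * apply wmean_bound with (m := fun t => 2 * K * M n t);
          [exact HP | exact Cw | lra | | apply is_RInt_majorant].
        intros t Ht. apply Hw. lra.
      * pose proof (HMS (2 * K)). nra.
Qed.

Lemma ex_series_exp (q : R) : ex_series (fun n => q ^ n / INR (fact n)).
Proof.
  apply ex_series_ext with (fun n => scal (pow_n (K := R_AbsRing) q n) (/ INR (fact n))).
  - intros n. rewrite pow_n_pow. reflexivity.
  - exists (exp q). exact (is_exp_Reals q).
Qed.

(** The terms are majorized by (|lambda| L a)^n / n!, so both series converge uniformly and the
    recursion can be summed under the means. In the equation for [xi] the term with [cE] has no
    factor [lambda]: it involves z_(n+1), which absorbs all of lambda^(n+1), and the missing head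
    z_0 is 0. *)
Lemma volterra_sum (P : R -> R) (cA cB cC cD cE : R -> C) (a : R) (lambda : C) :
  weight P -> 0 < a ->
  (forall t, continuous cA t) -> (forall t, continuous cB t) ->
  (forall t, continuous cC t) -> (forall t, continuous cD t) ->
  (forall t, continuous cE t) ->
  exists xi om : R -> C,
    (forall t, continuous xi t) /\ (forall t, continuous om t) /\
    (forall x, 0 <= x <= a ->
       is_series (fun n => lambda ^ n * fst (volterra P cA cB cC cD cE n) x)%C (xi x)) /\
    (forall x, 0 <= x <= a ->
       is_series (fun n => lambda ^ n * snd (volterra P cA cB cC cD cE n) x)%C (om x)) /\
    (forall x, 0 <= x <= a ->
       om x = (lambda * wmean P (fun t => cA t * xi t + cB t * om t) x)%C) /\
    (forall x, 0 <= x <= a ->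
       xi x = (1 + wmean (fun _ => 1)
         (fun t => lambda * (cC t * xi t + cD t * om t) + cE t * om t) x)%C).
Proof.
  intros HP Ha HA HB HC HD HE.
  set (X := fun n => fst (volterra P cA cB cC cD cE n)).
  set (Z := fun n => snd (volterra P cA cB cC cD cE n)).
  assert (CX : forall n t, continuous (X n) t)
    by (intros n; exact (proj1 (continuous_volterra P cA cB cC cD cE n HP HA HB HC HD HE))).
  assert (CZ : forall n t, continuous (Z n) t)
    by (intros n; exact (proj2 (continuous_volterra P cA cB cC cD cE n HP HA HB HC HD HE))).
  destruct (continuous_bounded a cA HA) as (KA & KA0 & KA1).
  destruct (continuous_bounded a cB HB) as (KB & KB0 & KB1).
  destruct (continuous_bounded a cC HC) as (KC & KC0 & KC1).
  destruct (continuous_bounded a cD HD) as (KD & KD0 & KD1).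
  destruct (continuous_bounded a cE HE) as (KE & KE0 & KE1).
  set (K := KA + KB + KC + KD + KE).
  assert (HK : 0 < K) by (unfold K; lra).
  set (L := 2 * K * (1 + K * a)).
  assert (Hbound : forall n t, 0 <= t <= a ->
            Cmod (lambda ^ n * X n t)%C <= (Cmod lambda * L * a) ^ n / INR (fact n) /\
            Cmod (lambda ^ n * Z n t)%C <= (Cmod lambda * L * a) ^ n / INR (fact n)).
  { intros n t Ht.
    destruct (volterra_bound P cA cB cC cD cE a K n t) as [B1 B2]; auto;
      try (intros s Hs; unfold K;
           first [specialize (KA1 s Hs) | idtac];
           first [specialize (KB1 s Hs) | idtac];
           first [specialize (KC1 s Hs) | idtac];
           first [specialize (KD1 s Hs) | idtac];
           first [specialize (KE1 s Hs) | idtac]; lra).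
    fold L (X n) in B1. fold L (Z n) in B2.
    assert (HL : 0 <= L).
    { unfold L. assert (0 < K * a) by now apply Rmult_lt_0_compat.
      apply Rmult_le_pos; lra. }
    assert (E : Cmod lambda ^ n * (L ^ n * (t ^ n / INR (fact n)))
                <= (Cmod lambda * L * a) ^ n / INR (fact n)).
    { rewrite !Rpow_mult_distr. unfold Rdiv. rewrite <- !Rmult_assoc.
      apply Rmult_le_compat_r; [left; apply Rinv_0_lt_compat, INR_fact_lt_0|].
      apply Rmult_le_compat_l; [|apply pow_incr; lra].
      apply Rmult_le_pos; apply pow_le; [apply Cmod_ge_0 | exact HL]. }
    rewrite !Cmod_mult, Cmod_pow.
    assert (Hl : 0 <= Cmod lambda ^ n) by (apply pow_le, Cmod_ge_0).
    split; (eapply Rle_trans; [apply Rmult_le_compat_l; [exact Hl | eassumption] | exact E]). }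
  destruct (weierstrass_M_test a (fun n t => lambda ^ n * X n t)%C
              (fun n => (Cmod lambda * L * a) ^ n / INR (fact n)) Ha) as (xi & Cxi & Uxi).
  { intros n. cont. }
  { intros n t Ht. now apply Hbound. }
  { apply ex_series_exp. }
  destruct (weierstrass_M_test a (fun n t => lambda ^ n * Z n t)%C
              (fun n => (Cmod lambda * L * a) ^ n / INR (fact n)) Ha) as (om & Com & Uom).
  { intros n. cont. }
  { intros n t Ht. now apply Hbound. }
  { apply ex_series_exp. }
  exists xi, om. split; [exact Cxi|]. split; [exact Com|].
  split; [intros x Hx; exact (unif_series_is_series _ _ _ x Uxi Hx)|].
  split; [intros x Hx; exact (unif_series_is_series _ _ _ x Uom Hx)|].
  split; intros x Hx.
  - pose proof (unif_series_is_series _ _ _ x (unif_series_shift _ _ _ Uom) Hx) as S1.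
    pose proof (unif_series_mult a (fun _ => lambda) _ _ (continuous_Cconst lambda)
      (unif_series_plus _ _ _ _ _ (unif_series_mult _ _ _ _ HA Uxi)
         (unif_series_mult _ _ _ _ HB Uom))) as U.
    apply (wmean_series P a x) in U; [| exact HP | | cont | exact Hx].
    2:{ intros n. cont. }
    rewrite <- wmean_scal; [| exact HP | cont].
    transitivity (om x - lambda ^ 0 * Z 0%nat x)%C; [unfold Z; simpl; ring|].
    apply (is_series_Cunique _ _ _ S1). apply is_series_ext with (2 := U). intros n.
    rewrite (wmean_ext P _ (fun t => lambda ^ S n * (cA t * X n t + cB t * Z n t))%C)
      by (intros t _; simpl; ring).
    now rewrite wmean_scal; [| exact HP | cont].
  - pose proof (unif_series_is_series _ _ _ x (unif_series_shift _ _ _ Uxi) Hx) as S1.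
    pose proof (unif_series_plus _ _ _ _ _
      (unif_series_mult a (fun _ => lambda) _ _ (continuous_Cconst lambda)
        (unif_series_plus _ _ _ _ _ (unif_series_mult _ _ _ _ HC Uxi)
           (unif_series_mult _ _ _ _ HD Uom)))
      (unif_series_mult _ _ _ _ HE (unif_series_shift _ _ _ Uom))) as U.
    assert (Co : forall t, continuous (fun t => om t - lambda ^ 0 * Z 0%nat t)%C t).
    { intros t. apply (filterlim_Cminus (locally t)); [apply Com|].
      apply (continuous_Cmult (fun _ => (lambda ^ 0)%C) (Z 0%nat)); cont. }
    apply (wmean_series (fun _ => 1) a x) in U; [| apply weight_one | | cont | exact Hx].
    2:{ intros n. cont. }
    rewrite (wmean_ext _ _ (fun t => lambda * (cC t * xi t + cD t * om t) +
               cE t * (om t - lambda ^ 0 * Z 0%nat t))%C)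
      by (intros t _; unfold Z; simpl; ring).
    transitivity (1 + (xi x - lambda ^ 0 * X 0%nat x))%C; [unfold X; simpl; ring|].
    f_equal.
    apply (is_series_Cunique _ _ _ S1). apply is_series_ext with (2 := U). intros n.
    rewrite (wmean_ext _ _ (fun t => lambda ^ S n *
               (cC t * X n t + cD t * Z n t + cE t * Z (S n) t))%C)
      by (intros t _; simpl; ring).
    now rewrite wmean_scal; [| apply weight_one | cont].
Qed.

(** * Derivatives relative to a set *)

(* Caratheodory's form of differentiability: product and quotient rules reduce to limits. *)
Definition slope_within (D : R -> Prop) (f : R -> C) (x : R) (l : C) : Prop :=
  exists q : R -> C,
    filterlim q (within D (locally x)) (locally l) /\
    forall y, D y -> f y = (f x + RtoC (y - x) * q y)%C.

(** Needed because [filterdiff] quantifies over all limit points of its filter; relative to [D], at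
    a point of [D], the base point is the only one. *)
Lemma is_filter_lim_within (D : R -> Prop) (x z : R) :
  D x -> is_filter_lim (within D (locally x)) z -> z = x.
Proof.
  intros HD H. apply Rminus_diag_uniq, cond_eq. intros eps He.
  rewrite Rminus_0_r.
  assert (Hl : locally z (fun y => Rabs (y - z) < eps)) by now apply (locally_Rabs z eps).
  specialize (H _ Hl). unfold within in H. apply locally_singleton in H.
  rewrite Rabs_minus_sym. now apply H.
Qed.

Lemma is_linear_scal_l_C (l : C) :
  is_linear (U := R_NormedModule) (V := C_R_NormedModule)
    (fun y : R => scal (V := C_R_NormedModule) y l).
Proof. exact (is_linear_scal_l (V := C_R_NormedModule) l). Qed.

Lemma is_derive_within_slope (D : R -> Prop) (f : R -> C) (x : R) (l : C) :
  D x -> is_derive_within D f x l -> slope_within D f x l.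
Proof.
  intros HD [_ H].
  assert (Hx : is_filter_lim (within D (locally x)) x).
  { intros P HP. unfold within. revert HP. apply filter_imp. auto. }
  specialize (H x Hx).
  exists (fun y => if Req_dec_T y x then l else ((f y - f x) / RtoC (y - x))%C). split.
  - apply filterlim_Cmod; [apply within_filter, locally_filter|]. intros eps He.
    assert (He2 : 0 < eps / 2) by lra.
    generalize (H (mkposreal _ He2)). unfold within. apply filter_imp. intros y K Dy.
    destruct (Req_dec_T y x) as [->|Hy].
    + replace (l - l)%C with (RtoC 0) by ring. now rewrite Cmod_0.
    + specialize (K Dy).
      change (norm (V := C_R_NormedModule)
                (f y - f x - scal (V := C_R_NormedModule) (y - x)%R l)%C
              <= eps / 2 * Rabs (y - x)) in K.
      rewrite <- Cmod_norm, scal_R_Cmult in K.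
      assert (Hn : RtoC (y - x) <> RtoC 0).
      { intros E. apply RtoC_inj in E. apply Hy. lra. }
      replace ((f y - f x) / RtoC (y - x) - l)%C
        with ((f y - f x - RtoC (y - x) * l) / RtoC (y - x))%C by (field; exact Hn).
      rewrite Cmod_div, Cmod_R by exact Hn.
      assert (Hp : 0 < Rabs (y - x)) by (apply Rabs_pos_lt; lra).
      apply Rle_lt_trans with (eps / 2 * Rabs (y - x) / Rabs (y - x)).
      * apply Rmult_le_compat_r; [left; now apply Rinv_0_lt_compat | exact K].
      * replace (eps / 2 * Rabs (y - x) / Rabs (y - x)) with (eps / 2) by (field; lra). lra.
  - intros y _. destruct (Req_dec_T y x) as [->|Hy].
    + rewrite Rminus_diag. ring.
    + field. intros E. apply RtoC_inj in E. apply Hy. lra.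
Qed.

Lemma slope_is_derive_within (D : R -> Prop) (f : R -> C) (x : R) (l : C) :
  D x -> slope_within D f x l -> is_derive_within D f x l.
Proof.
  intros HD (q & Hq & Hf). split; [apply is_linear_scal_l_C|].
  intros z Hz. apply (is_filter_lim_within D x z HD) in Hz. subst z. intros eps.
  generalize (proj1 (filterlim_Cmod _ q l) Hq eps (cond_pos eps)).
  unfold within. apply filter_imp. intros y K Dy. specialize (K Dy).
  change (norm (V := C_R_NormedModule)
            (f y - f x - scal (V := C_R_NormedModule) (y - x)%R l)%C
          <= eps * Rabs (y - x)).
  rewrite <- Cmod_norm, scal_R_Cmult, (Hf y Dy).
  replace (f x + RtoC (y - x) * q y - f x - RtoC (y - x) * l)%C
    with (RtoC (y - x) * (q y - l))%C by ring.
  rewrite Cmod_mult, Cmod_R, Rmult_comm.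
  apply Rmult_le_compat_r; [apply Rabs_pos | lra].
Qed.

Lemma slope_within_derive (D : R -> Prop) (f : R -> C) (x : R) (l : C) :
  D x -> is_derive (V := C_R_NormedModule) f x l -> slope_within D f x l.
Proof.
  intros HD [_ H]. apply is_derive_within_slope; [exact HD|].
  split; [apply is_linear_scal_l_C|].
  intros z Hz. apply (is_filter_lim_within D x z HD) in Hz. subst z. intros eps.
  assert (Hx : is_filter_lim (locally x) x) by (intros P HP; exact HP).
  generalize (H x Hx eps). unfold within. apply filter_imp. auto.
Qed.

Lemma slope_within_ext (D : R -> Prop) (f h : R -> C) (x : R) (l : C) :
  D x -> (forall y, D y -> f y = h y) -> slope_within D f x l -> slope_within D h x l.
Proof.
  intros HD E (q & Hq & Hf). exists q. split; [exact Hq|].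
  intros y Hy. rewrite <- !E by assumption. now apply Hf.
Qed.

Lemma slope_within_continuous (D : R -> Prop) (f : R -> C) (x : R) (l : C) :
  slope_within D f x l -> filterlim f (within D (locally x)) (locally (f x)).
Proof.
  intros (q & Hq & Hf).
  apply filterlim_within_ext with (fun y => f x + RtoC (y - x) * q y)%C.
  { intros y Hy. symmetry. now apply Hf. }
  replace (locally (f x)) with (locally (f x + RtoC (x - x) * l)%C)
    by (f_equal; rewrite Rminus_diag; ring).
  apply filterlim_Cplus; [apply within_filter, locally_filter | apply filterlim_const |].
  apply filterlim_Cmult; [apply within_filter, locally_filter | | exact Hq].
  apply (continuous_within D x (fun y => RtoC (y - x))).
  apply (filterlim_RtoC (locally x)).
  apply (continuous_minus (V := R_NormedModule)); [apply continuous_id | apply continuous_const].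
Qed.

Lemma slope_within_plus (D : R -> Prop) (f h : R -> C) (x : R) (l m : C) :
  slope_within D f x l -> slope_within D h x m ->
  slope_within D (fun y => f y + h y)%C x (l + m)%C.
Proof.
  intros (q & Hq & Hf) (r & Hr & Hh). exists (fun y => q y + r y)%C. split.
  - apply filterlim_Cplus; [apply within_filter, locally_filter | exact Hq | exact Hr].
  - intros y Hy. rewrite (Hf y Hy), (Hh y Hy). ring.
Qed.

Lemma slope_within_const (D : R -> Prop) (c : C) (x : R) :
  slope_within D (fun _ => c) x (RtoC 0).
Proof.
  exists (fun _ => RtoC 0). split; [apply filterlim_const|]. intros y _. ring.
Qed.

Lemma slope_within_mult (D : R -> Prop) (f h : R -> C) (x : R) (l m : C) :
  slope_within D f x l -> slope_within D h x m ->
  slope_within D (fun y => f y * h y)%C x (l * h x + f x * m)%C.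
Proof.
  intros Sf Sh. pose proof (slope_within_continuous _ _ _ _ Sh) as Ch.
  destruct Sf as (q & Hq & Hf). destruct Sh as (r & Hr & Hh).
  exists (fun y => q y * h y + f x * r y)%C. split.
  - apply filterlim_Cplus; [apply within_filter, locally_filter | |];
      (apply filterlim_Cmult; [apply within_filter, locally_filter | |]);
      try assumption. apply filterlim_const.
  - intros y Hy. rewrite (Hf y Hy), (Hh y Hy). ring.
Qed.

Lemma slope_within_inv (D : R -> Prop) (f : R -> C) (x : R) (l : C) :
  D x -> (forall y, D y -> f y <> RtoC 0) -> slope_within D f x l ->
  slope_within D (fun y => / f y)%C x (- l / (f x * f x))%C.
Proof.
  intros HD H0 Sf. pose proof (slope_within_continuous _ _ _ _ Sf) as Cf.
  destruct Sf as (q & Hq & Hf).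
  exists (fun y => - q y / (f x * f y))%C. split.
  - apply filterlim_Cdiv; [apply within_filter, locally_filter | | |].
    + apply Cmult_neq_0; now apply H0.
    + apply filterlim_Copp; [apply within_filter, locally_filter | exact Hq].
    + apply filterlim_Cmult; [apply within_filter, locally_filter | | exact Cf].
      apply filterlim_const.
  - intros y Hy. pose proof (H0 y Hy) as Hy0. pose proof (H0 x HD) as Hx0.
    assert (E : (RtoC (y - x) * q y)%C = (f y - f x)%C) by (rewrite (Hf y Hy); ring).
    replace (/ f x + RtoC (y - x) * (- q y / (f x * f y)))%C
      with (/ f x - (RtoC (y - x) * q y) / (f x * f y))%C by (field; auto).
    rewrite E. field. auto.
Qed.

(** * Formal powers *)

(* The kernels of the Volterra system satisfied by [X / f] and [(f Y - g X) / P]. *)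
Definition reduced_kernels (a : R) (P : R -> R) (f g p2 r11 r12 r21 r22 : R -> C)
    (cA cB cC cD cE : R -> C) : Prop :=
  forall t, Ioc0 a t ->
    (RtoC (P t) * cA t = f t * (f t * r11 t + g t * r21 t)
                         + g t * (f t * r12 t + g t * r22 t))%C /\
    cB t = ((f t * r12 t + g t * r22 t) / f t)%C /\
    cC t = (- r21 t - r22 t * g t / f t)%C /\
    cD t = (- r22 t * RtoC (P t) / (f t * f t))%C /\
    cE t = (p2 t * RtoC (P t) / (f t * f t))%C.

(** After substitution of the form of [X] and [Y], the integrand equals c P (cA xi + cB z) on (0,x),
    and this is continuous up to 0. The integral thus exists and is a weighted mean times P(x). *)
Lemma Z_integrand_is_RInt (a : R) (P : R -> R) (f g p2 r11 r12 r21 r22 : R -> C)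
    (cA cB cC cD cE xi z X Y : R -> C) (c : C) (x : R) :
  weight P -> (forall t, Ioc0 a t -> f t <> RtoC 0) ->
  reduced_kernels a P f g p2 r11 r12 r21 r22 cA cB cC cD cE ->
  (forall t, continuous cA t) -> (forall t, continuous cB t) ->
  (forall t, continuous xi t) -> (forall t, continuous z t) ->
  (forall t, Ioc0 a t ->
     X t = (c * (f t * xi t))%C /\ Y t = (c * (g t * xi t + RtoC (P t) * z t / f t))%C) ->
  Ioc0 a x ->
  is_RInt (V := C_R_NormedModule) (Z_integrand f g r11 r12 r21 r22 X Y) 0 x
    (c * (RtoC (P x) * wmean P (fun t => cA t * xi t + cB t * z t) x))%C.
Proof.
  intros HP Hf HK CA CB Cxi Cz HXY [Hx0 Hxa].
  apply (is_RInt_ext (V := C_R_NormedModule))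
    with (f := fun t => (c * (RtoC (P t) * (cA t * xi t + cB t * z t)))%C).
  - intros t Ht. rewrite Rmin_left, Rmax_right in Ht by lra.
    assert (HD : Ioc0 a t) by (split; lra).
    destruct (HK t HD) as (KA & KB & _). destruct (HXY t HD) as [EX EY].
    unfold Z_integrand. rewrite EX, EY, KB.
    replace (c * (RtoC (P t) * (cA t * xi t + (f t * r12 t + g t * r22 t) / f t * z t)))%C
      with (c * (RtoC (P t) * cA t * xi t
                 + RtoC (P t) * ((f t * r12 t + g t * r22 t) / f t) * z t))%C by ring.
    rewrite KA.
    Ceq.
    field. now apply Hf.
  - apply is_RInt_Cmult_l. apply wmean_is_RInt; [exact HP | cont | exact Hx0].
Qed.

(** The factor [P] carried by [Z] is combined with p2 / f^2 into [cE]; this is where the singularity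
    at 0 disappears. *)
Lemma X_integrand_is_RInt (a : R) (P : R -> R) (f g p2 r11 r12 r21 r22 : R -> C)
    (cA cB cC cD cE xi z z' X Y Z : R -> C) (c : C) (x : R) :
  (forall t, Ioc0 a t -> f t <> RtoC 0) ->
  reduced_kernels a P f g p2 r11 r12 r21 r22 cA cB cC cD cE ->
  (forall t, continuous cC t) -> (forall t, continuous cD t) ->
  (forall t, continuous cE t) ->
  (forall t, continuous xi t) -> (forall t, continuous z t) -> (forall t, continuous z' t) ->
  (forall t, Ioc0 a t ->
     X t = (c * (f t * xi t))%C /\ Y t = (c * (g t * xi t + RtoC (P t) * z t / f t))%C) ->
  (forall t, Ioc0 a t -> Z t = (c * (RtoC (P t) * z' t))%C) ->
  Ioc0 a x ->
  is_RInt (V := C_R_NormedModule) (X_integrand f p2 r21 r22 X Y Z) 0 x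
    (c * wmean (fun _ => 1) (fun t => cC t * xi t + cD t * z t + cE t * z' t) x)%C.
Proof.
  intros Hf HK CC CD CE Cxi Cz Cz' HXY HZ [Hx0 Hxa].
  (* The inserted 1 is the constant weight, so that the integral of the right-hand side is supplied
     by [wmean_is_RInt]. *)
  rewrite <- (Cmult_1_l (wmean _ _ _)).
  apply (is_RInt_ext (V := C_R_NormedModule))
    with (f := fun t => (c * (1 * (cC t * xi t + cD t * z t + cE t * z' t)))%C).
  - intros t Ht. rewrite Rmin_left, Rmax_right in Ht by lra.
    assert (HD : Ioc0 a t) by (split; lra).
    destruct (HK t HD) as (_ & _ & KC & KD & KE). destruct (HXY t HD) as [EX EY].
    unfold X_integrand. rewrite EX, EY, (HZ t HD), KC, KD, KE.
    Ceq.
    field. now apply Hf.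
  - apply is_RInt_Cmult_l.
    apply (wmean_is_RInt (fun _ => 1)); [apply weight_one | cont | exact Hx0].
Qed.

(** Induction on [n], where the prefactor n + 1 of the recursion turns n! into (n+1)!. Existence of
    the integrals comes with their values, since both are read from [is_RInt]. *)
Lemma formal_powers_volterra (a : R) (P : R -> R) (f g p2 r11 r12 r21 r22 : R -> C)
    (cA cB cC cD cE : R -> C) :
  weight P -> (forall t, Ioc0 a t -> f t <> RtoC 0) ->
  reduced_kernels a P f g p2 r11 r12 r21 r22 cA cB cC cD cE ->
  (forall t, continuous cA t) -> (forall t, continuous cB t) ->
  (forall t, continuous cC t) -> (forall t, continuous cD t) ->
  (forall t, continuous cE t) ->
  formal_powers_defined a f g p2 r11 r12 r21 r22 /\
  forall n x, Ioc0 a x ->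
    Xhat f g p2 r11 r12 r21 r22 n x
    = (RtoC (INR (fact n)) * (f x * fst (volterra P cA cB cC cD cE n) x))%C /\
    Yhat f g p2 r11 r12 r21 r22 n x
    = (RtoC (INR (fact n)) * (g x * fst (volterra P cA cB cC cD cE n) x
         + RtoC (P x) * snd (volterra P cA cB cC cD cE n) x / f x))%C.
Proof.
  intros HP Hf HK CA CB CC CD CE.
  set (xi := fun n => fst (volterra P cA cB cC cD cE n)).
  set (z := fun n => snd (volterra P cA cB cC cD cE n)).
  assert (Cxi : forall n t, continuous (xi n) t)
    by (intros n; exact (proj1 (continuous_volterra P cA cB cC cD cE n HP CA CB CC CD CE))).
  assert (Cz : forall n t, continuous (z n) t)
    by (intros n; exact (proj2 (continuous_volterra P cA cB cC cD cE n HP CA CB CC CD CE))).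
  set (X := Xhat f g p2 r11 r12 r21 r22). set (Y := Yhat f g p2 r11 r12 r21 r22).
  set (Z := Zhat f g p2 r11 r12 r21 r22).
  set (c := fun n => RtoC (INR (fact n))).
  (* [HZ] and [HX] take the claim at [n] as a premise: they serve first in the induction step and
     afterwards, with the claim proved for all [n], for the existence of the integrals. *)
  assert (HZ : forall n, (forall t, Ioc0 a t -> X n t = (c n * (f t * xi n t))%C /\
              Y n t = (c n * (g t * xi n t + RtoC (P t) * z n t / f t))%C) ->
            forall t, Ioc0 a t -> is_RInt (V := C_R_NormedModule)
              (Z_integrand f g r11 r12 r21 r22 (X n) (Y n)) 0 t
              (c n * (RtoC (P t) * z (S n) t))%C).
  { intros n H t Ht.
    exact (Z_integrand_is_RInt a P f g p2 r11 r12 r21 r22 cA cB cC cD cE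
             (xi n) (z n) (X n) (Y n) (c n) t HP Hf HK CA CB (Cxi n) (Cz n) H Ht). }
  assert (HX : forall n, (forall t, Ioc0 a t -> X n t = (c n * (f t * xi n t))%C /\
              Y n t = (c n * (g t * xi n t + RtoC (P t) * z n t / f t))%C) ->
            forall t, Ioc0 a t -> is_RInt (V := C_R_NormedModule)
              (X_integrand f p2 r21 r22 (X n) (Y n) (Z n)) 0 t (c n * xi (S n) t)%C).
  { intros n H t Ht.
    apply (X_integrand_is_RInt a P f g p2 r11 r12 r21 r22 cA cB cC cD cE
             (xi n) (z n) (z (S n)) (X n) (Y n) (Z n) (c n) t Hf HK CC CD CE
             (Cxi n) (Cz n) (Cz (S n)) H); [|exact Ht].
    intros y Hy. apply CRInt_unique. now apply HZ. }
  assert (HXY : forall n t, Ioc0 a t -> X n t = (c n * (f t * xi n t))%C /\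
              Y n t = (c n * (g t * xi n t + RtoC (P t) * z n t / f t))%C).
  { induction n as [|n IH]; intros t Ht; pose proof (Hf t Ht) as Hft.
    - unfold X, Y, Xhat, Yhat, xi, z, c. simpl. split; field; exact Hft.
    - assert (EX : X (S n) t = (RtoC (INR (S n)) * f t * (c n * xi (S n) t))%C).
      { unfold X, Xhat at 1. simpl formal_powers. simpl fst. f_equal.
        apply CRInt_unique. exact (HX n IH t Ht). }
      assert (EY : Y (S n) t = (RtoC (INR (S n)) * (1 / f t) * (c n * (RtoC (P t) * z (S n) t))
                                 + g t / f t * X (S n) t)%C).
      { unfold Y, Yhat at 1. simpl formal_powers. simpl snd. f_equal. f_equal.
        apply CRInt_unique. exact (HZ n IH t Ht). }
      assert (Ec : c (S n) = (RtoC (INR (S n)) * c n)%C).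
      { unfold c. now rewrite fact_simpl, mult_INR, RtoC_mult. }
      rewrite EY, EX, Ec. split; field; exact Hft. }
  split; [|exact HXY].
  intros n x Hx. split.
  - eexists. exact (HZ n (HXY n) x Hx).
  - eexists. exact (HX n (HXY n) x Hx).
Qed.

Lemma homogeneous_slopes (a kappa : R) (p1 p2 q f g : R -> C) (x : R) :
  homogeneous_solution a kappa p1 p2 q f g -> Ioc0 a x ->
  slope_within (Ioc0 a) f x ((RtoC (kappa / x) + q x) * f x + p2 x * g x)%C /\
  slope_within (Ioc0 a) g x (- (p1 x * f x) - (RtoC (kappa / x) + q x) * g x)%C.
Proof.
  intros (df & dg & [Hf _] & [Hg _] & Hs) Hx.
  destruct (Hs x Hx) as [E1 E2].
  apply (f_equal (fun y => y - RtoC 0)%C) in E1. apply (f_equal (fun y => y - RtoC 0)%C) in E2.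
  replace ((RtoC (kappa / x) + q x) * f x + p2 x * g x)%C with (df x).
  - replace (- (p1 x * f x) - (RtoC (kappa / x) + q x) * g x)%C with (dg x).
    + split; apply is_derive_within_slope; auto.
    + replace (dg x) with (dg x + p1 x * f x + (RtoC (kappa / x) + q x) * g x - 0
        + (- (p1 x * f x) - (RtoC (kappa / x) + q x) * g x))%C by ring.
      rewrite E1. ring.
  - replace (df x) with ((RtoC (kappa / x) + q x) * f x + p2 x * g x
      - (- df x + (RtoC (kappa / x) + q x) * f x + p2 x * g x - 0))%C by ring.
    rewrite E2. ring.
Qed.

Lemma slope_within_CRInt (a : R) (h : R -> C) (x : R) :
  (forall t, continuous h t) -> Ioc0 a x ->
  slope_within (Ioc0 a) (CRInt h 0) x (h x).
Proof. intros Hh Hx. apply slope_within_derive; [exact Hx | now apply is_derive_CRInt]. Qed.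

(** Product rule and cancellation. In u', f cE om = p2 P om / f completes p2 g xi to p2 v. In v',
    the derivative of 1/f contributes -(kappa/x + q) P om / f, which completes the term in v, and
    -p2 g P om / f^2, which cancels g cE om. Among the terms with lambda, all those with r21 and r22
    cancel in v'. *)
Lemma volterra_solution_slopes (a kappa : R) (P : R -> R)
    (p1 p2 q r11 r12 r21 r22 f g : R -> C)
    (cA cB cC cD cE xi om : R -> C) (lambda : C) (x : R) :
  weight P -> (forall t, Ioc0 a t -> f t <> RtoC 0) ->
  reduced_kernels a P f g p2 r11 r12 r21 r22 cA cB cC cD cE ->
  homogeneous_solution a kappa p1 p2 q f g ->
  (forall t, continuous cA t) -> (forall t, continuous cB t) ->
  (forall t, continuous cC t) -> (forall t, continuous cD t) ->
  (forall t, continuous cE t) ->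
  (forall t, continuous xi t) -> (forall t, continuous om t) ->
  (forall x, 0 <= x <= a ->
     om x = (lambda * wmean P (fun t => cA t * xi t + cB t * om t) x)%C) ->
  (forall x, 0 <= x <= a ->
     xi x = (1 + wmean (fun _ => 1)
       (fun t => lambda * (cC t * xi t + cD t * om t) + cE t * om t) x)%C) ->
  Ioc0 a x ->
  let u := fun t => (f t * xi t)%C in
  let v := fun t => (g t * xi t + RtoC (P t) * om t / f t)%C in
  slope_within (Ioc0 a) u x
    ((RtoC (kappa / x) + q x) * u x + p2 x * v x - lambda * (r21 x * u x + r22 x * v x))%C /\
  slope_within (Ioc0 a) v x
    (lambda * (r11 x * u x + r12 x * v x) - p1 x * u x - (RtoC (kappa / x) + q x) * v x)%C.
Proof.
  intros HP Hf HK Hfg CA CB CC CD CE Cxi Com Eom Exi Hx u v.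
  destruct (homogeneous_slopes a kappa p1 p2 q f g x Hfg Hx) as [Sf Sg].
  destruct (HK x Hx) as (KA & KB & KC & KD & KE). pose proof (Hf x Hx) as Hfx.
  set (w1 := fun t => (lambda * (cC t * xi t + cD t * om t) + cE t * om t)%C).
  set (w2 := fun t => (cA t * xi t + cB t * om t)%C).
  assert (Sxi : slope_within (Ioc0 a) xi x (w1 x)).
  { apply slope_within_ext with (fun t => 1 + CRInt w1 0 t)%C; [exact Hx | |].
    - intros y Hy. rewrite (Exi y) by (unfold Ioc0 in Hy; lra). f_equal.
      rewrite <- (Cmult_1_l (wmean _ _ _)).
      rewrite (wmean_pos (fun _ => 1)); [| apply weight_one | apply Hy].
      apply (RInt_ext (V := C_R_CompleteNormedModule)). intros t _. symmetry.
      apply Cmult_1_l.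
    - rewrite <- (Cplus_0_l (w1 x)).
      apply slope_within_plus; [apply slope_within_const|].
      apply slope_within_CRInt; [unfold w1; cont | exact Hx]. }
  (* The product P om is differentiated as a whole, being lambda times an integral; the derivative
     of [P] never enters. *)
  assert (SW : slope_within (Ioc0 a) (fun t => RtoC (P t) * om t)%C x
                 (lambda * (RtoC (P x) * w2 x))%C).
  { apply slope_within_ext with
      (fun t => lambda * CRInt (fun t => RtoC (P t) * w2 t)%C 0 t)%C; [exact Hx | |].
    - intros y Hy. rewrite (Eom y) by (unfold Ioc0 in Hy; lra).
      rewrite <- wmean_pos; [| exact HP | apply Hy]. unfold w2. ring.
    - replace (lambda * (RtoC (P x) * w2 x))%C
        with (0 * CRInt (fun t => RtoC (P t) * w2 t)%C 0 x
              + lambda * (RtoC (P x) * w2 x))%C by ring.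
      apply (slope_within_mult _ (fun _ => lambda)); [apply slope_within_const|].
      apply (slope_within_CRInt a (fun t => RtoC (P t) * w2 t)%C); [|exact Hx].
      apply continuous_weighted; [exact HP | unfold w2; cont]. }
  split.
  - replace ((RtoC (kappa / x) + q x) * u x + p2 x * v x
             - lambda * (r21 x * u x + r22 x * v x))%C
      with (((RtoC (kappa / x) + q x) * f x + p2 x * g x) * xi x + f x * w1 x)%C.
    + exact (slope_within_mult _ _ _ _ _ _ Sf Sxi).
    + unfold w1, u, v. rewrite KC, KD, KE. field. exact Hfx.
  - pose proof (slope_within_plus _ _ _ _ _ _
      (slope_within_mult _ _ _ _ _ _ Sg Sxi)
      (slope_within_mult _ _ _ _ _ _ SW (slope_within_inv _ _ _ _ Hx Hf Sf))) as H.
    refine (eq_ind _ (slope_within (Ioc0 a) v x) H _ _).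
    replace (RtoC (P x) * w2 x)%C with (RtoC (P x) * cA x * xi x + RtoC (P x) * cB x * om x)%C
      by (unfold w2; ring).
    rewrite KA, KB. unfold w1, u, v. rewrite KC, KD, KE. field. exact Hfx.
Qed.

(** * Asymptotics at the origin *)

Lemma cpower_neq_0 (x k : R) : cpower x k <> RtoC 0.
Proof. intros E. apply RtoC_inj in E. pose proof (Rpower_gt_0 x k). lra. Qed.

Lemma cpower_succ (x k : R) : 0 < x -> cpower x (k + 1) = (RtoC x * cpower x k)%C.
Proof.
  intros Hx. unfold cpower. rewrite Rpower_plus, Rpower_1, RtoC_mult by exact Hx. ring.
Qed.

Lemma continuous_cpower (k x : R) : 0 < x -> continuous (fun t => cpower t k) x.
Proof.
  intros Hx. apply (filterlim_RtoC (locally x) (fun t => Rpower t k)).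
  apply (ex_derive_continuous (V := R_NormedModule) (fun t => Rpower t k)).
  eexists. exact (is_derive_Rpower x k Hx).
Qed.

Lemma asymp_equiv_ratio (h m : R -> C) :
  (forall x, m x <> RtoC 0) -> asymp_equiv h m ->
  filterlim (fun x => h x / m x)%C (at_right 0) (locally (RtoC 1)).
Proof.
  intros Hm (eps & He & Hh).
  apply filterlim_ext_loc with (fun x => 1 + eps x)%C.
  - generalize Hh. apply filter_imp. intros x ->. field. apply Hm.
  - replace (locally (RtoC 1)) with (locally (1 + 0)%C) by (f_equal; ring).
    apply filterlim_Cplus; [typeclasses eauto | apply filterlim_const | exact He].
Qed.

Lemma ratio_asymp_equiv (h m : R -> C) :
  (forall x, m x <> RtoC 0) ->
  filterlim (fun x => h x / m x)%C (at_right 0) (locally (RtoC 1)) -> asymp_equiv h m.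
Proof.
  intros Hm H. exists (fun x => h x / m x - 1)%C. split.
  - replace (locally (RtoC 0)) with (locally (1 - 1)%C) by (f_equal; ring).
    apply filterlim_Cminus; [typeclasses eauto | exact H | apply filterlim_const].
  - apply filter_forall. intros x. field. apply Hm.
Qed.

(** One limit covers both readings of the relation: for [c] nonzero divide by [c], and for [c = 0]
    the quotient itself is the o(1) factor. *)
Lemma ratio_asymp_power (h : R -> C) (c : C) (k : R) :
  filterlim (fun x => h x / cpower x k)%C (at_right 0) (locally c) -> asymp_power h c k.
Proof.
  intros H. split; intros Hc.
  - apply ratio_asymp_equiv.
    + intros x. apply Cmult_neq_0; [exact Hc | apply cpower_neq_0].
    + apply filterlim_ext with (fun x => h x / cpower x k / c)%C.
      * intros x. field. split; [apply cpower_neq_0 | exact Hc].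
      * replace (locally (RtoC 1)) with (locally (c / c)%C) by (f_equal; field; exact Hc).
        apply filterlim_Cdiv; [typeclasses eauto | exact Hc | exact H | apply filterlim_const].
  - exists (fun x => h x / cpower x k)%C. split; [now rewrite <- Hc|].
    apply filter_forall. intros x. field. apply cpower_neq_0.
Qed.

Lemma filterlim_bounded_at_0 (h : R -> C) (l : C) :
  filterlim h (at_right 0) (locally l) -> bounded_at_0 h.
Proof.
  intros H. exists (Cmod l + 1).
  generalize (proj1 (filterlim_Cmod (at_right 0) h l) H 1 ltac:(lra)).
  apply filter_imp. intros x Hx.
  replace (h x) with (h x - l + l)%C by ring.
  pose proof (Cmod_triangle (h x - l)%C l). lra.
Qed.

Theorem theorem2p8 :
  forall (a kappa : R) (p1 p2 q r11 r12 r21 r22 : R -> C) (lambda : C)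
         (f g : R -> C),
    0 < a ->
    1 / 2 <= kappa ->
    continuous_on (Icc0 a) p1 ->
    continuous_on (Icc0 a) p2 ->
    continuous_on (Icc0 a) q ->
    continuous_on (Icc0 a) r11 ->
    continuous_on (Icc0 a) r12 ->
    continuous_on (Icc0 a) r21 ->
    continuous_on (Icc0 a) r22 ->
    p1 0 <> RtoC 0 ->
    homogeneous_solution a kappa p1 p2 q f g ->
    asymp_equiv f (fun x => cpower x kappa) ->
    asymp_equiv g
      (fun x => (- p1 0 / RtoC (2 * kappa + 1) * cpower x (kappa + 1))%C) ->
    (forall x : R, Ioc0 a x -> f x <> RtoC 0) ->
    formal_powers_defined a f g p2 r11 r12 r21 r22 /\
    exists u v : R -> C,
      regular_solution a kappa p1 p2 q r11 r12 r21 r22 lambda u v /\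
      forall x : R, Ioc0 a x ->
        is_series
          (fun n => (Cpow lambda n / RtoC (INR (fact n))
                     * Xhat f g p2 r11 r12 r21 r22 n x)%C) (u x) /\
        is_series
          (fun n => (Cpow lambda n / RtoC (INR (fact n))
                     * Yhat f g p2 r11 r12 r21 r22 n x)%C) (v x).
Proof.
  intros a kappa p1 p2 q r11 r12 r21 r22 lambda f g Ha Hkappa
    Hp1 Hp2 Hq Hr11 Hr12 Hr21 Hr22 Hp10 Hfg Hf Hg Hf0.
  (* The value at 0 is kept for [p1] and [r11] only, the two coefficients that enter mu. *)
  destruct (continuous_extension_Icc0 a p1 Ha Hp1) as (P1 & CP1 & EP1 & P10).
  destruct (continuous_extension_Icc0 a p2 Ha Hp2) as (P2 & CP2 & EP2 & _).
  destruct (continuous_extension_Icc0 a q Ha Hq) as (Q & CQ & EQ & _).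
  destruct (continuous_extension_Icc0 a r11 Ha Hr11) as (R11 & CR11 & ER11 & R110).
  destruct (continuous_extension_Icc0 a r12 Ha Hr12) as (R12 & CR12 & ER12 & _).
  destruct (continuous_extension_Icc0 a r21 Ha Hr21) as (R21 & CR21 & ER21 & _).
  destruct (continuous_extension_Icc0 a r22 Ha Hr22) as (R22 & CR22 & ER22 & _).
  assert (HkC : RtoC kappa <> RtoC 0) by (intros E; apply RtoC_inj in E; lra).
  assert (H2kC : RtoC (2 * kappa + 1) <> RtoC 0) by (intros E; apply RtoC_inj in E; lra).
  assert (Hs0 : forall x, cpower x kappa <> RtoC 0) by (intros; apply cpower_neq_0).
  assert (Hcf : continuous_on (Ioc0 a) f).
  { intros x Hx. eapply slope_within_continuous.
    now apply (homogeneous_slopes a kappa p1 p2 q f g). }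
  assert (Hcg : continuous_on (Ioc0 a) g).
  { intros x Hx. eapply slope_within_continuous.
    now apply (homogeneous_slopes a kappa p1 p2 q f g). }
  assert (Hdiv : forall h, continuous_on (Ioc0 a) h ->
            continuous_on (Ioc0 a) (fun x => h x / cpower x kappa)%C).
  { intros h Hh x Hx. apply filterlim_Cdiv; [typeclasses eauto | apply Hs0 | now apply Hh |].
    apply (continuous_within _ x (fun x => cpower x kappa)), continuous_cpower, Hx. }
  set (G0 := (- p1 0 / RtoC (2 * kappa + 1))%C).
  assert (Lf : filterlim (fun x => f x / cpower x kappa)%C (at_right 0) (locally (RtoC 1)))
    by now apply asymp_equiv_ratio.
  (* The hypothesis on [p1 0] makes the comparison function of [g] nonzero, so that equivalence can
     be restated as the limit of a quotient. *)
  assert (Lg1 : filterlim (fun x => g x / cpower x (kappa + 1))%C (at_right 0) (locally G0)).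
  { assert (HG0 : G0 <> RtoC 0).
    { unfold G0. intros E. apply Hp10.
      replace (p1 0) with (- (- p1 0 / RtoC (2 * kappa + 1)) * RtoC (2 * kappa + 1))%C
        by (field; exact H2kC).
      rewrite E. ring. }
    apply filterlim_ext with (fun x => G0 * (g x / (G0 * cpower x (kappa + 1))))%C.
    - intros x. field. split; [apply cpower_neq_0 | exact HG0].
    - replace (locally G0) with (locally (G0 * 1)%C) by (f_equal; ring).
      apply filterlim_Cmult; [typeclasses eauto | apply filterlim_const |].
      apply asymp_equiv_ratio; [|exact Hg].
      intros x. apply Cmult_neq_0; [exact HG0 | apply cpower_neq_0]. }
  assert (Lid : filterlim (fun x => RtoC x) (at_right 0) (locally (RtoC 0))).
  { apply (continuous_at_right 0 (fun x => RtoC x)).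
    apply (filterlim_RtoC (locally 0)), continuous_id. }
  assert (Lg : filterlim (fun x => g x / cpower x kappa)%C (at_right 0) (locally (RtoC 0))).
  { apply filterlim_ext_loc with (fun x => RtoC x * (g x / cpower x (kappa + 1)))%C.
    - generalize (at_right_Ioc0 a Ha). apply filter_imp. intros x [Hx _].
      rewrite cpower_succ by exact Hx. field. split; [apply Hs0|].
      intros E. apply RtoC_inj in E. lra.
    - replace (locally (RtoC 0)) with (locally (0 * G0)%C) by (f_equal; ring).
      apply filterlim_Cmult; [typeclasses eauto | exact Lid | exact Lg1]. }
  (* [phi] and [gam] extend f / x^kappa and g / x^kappa, with values 1 and 0 at the origin. *)
  destruct (continuous_extension a _ _ Ha (Hdiv f Hcf) Lf) as (phi & Cphi & Ephi & phi0 & Vphi).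
  destruct (continuous_extension a _ _ Ha (Hdiv g Hcg) Lg) as (gam & Cgam & Egam & gam0 & _).
  assert (Hphi : forall x, phi x <> RtoC 0).
  { intros x. destruct (Vphi x) as [->|(y & Hy & ->)].
    - intros E. apply RtoC_inj in E. lra.
    - intros E. apply (Hf0 y Hy).
      replace (f y) with (f y / cpower y kappa * cpower y kappa)%C by (field; apply Hs0).
      rewrite E. ring. }
  assert (Ef : forall x, Ioc0 a x -> f x = (cpower x kappa * phi x)%C).
  { intros x Hx. rewrite (Ephi x Hx). field. apply Hs0. }
  assert (Eg : forall x, Ioc0 a x -> g x = (cpower x kappa * gam x)%C).
  { intros x Hx. rewrite (Egam x Hx). field. apply Hs0. }
  set (iphi := fun x => (/ phi x)%C).
  assert (Ciphi : forall x, continuous iphi x).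
  { intros x. apply (filterlim_Cinv (locally x)); [apply Hphi | apply Cphi]. }
  set (P := pospow (2 * kappa)).
  assert (HP : weight P) by (apply weight_pospow; lra).
  assert (EP : forall x, 0 < x -> RtoC (P x) = (cpower x kappa * cpower x kappa)%C).
  { intros x Hx. unfold P, cpower. rewrite pospow_pos by exact Hx.
    rewrite <- RtoC_mult, <- Rpower_plus. do 2 f_equal. ring. }
  set (cA := fun t => (phi t * (phi t * R11 t + gam t * R21 t)
                       + gam t * (phi t * R12 t + gam t * R22 t))%C).
  set (cB := fun t => ((phi t * R12 t + gam t * R22 t) * iphi t)%C).
  (* Signs are written as factors [- (1)] because [cont] decomposes only sums, products and
     constants. *)
  set (cC := fun t => (- (1) * R21 t + - (1) * (R22 t * gam t * iphi t))%C).
  set (cD := fun t => (- (1) * (R22 t * iphi t * iphi t))%C).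
  set (cE := fun t => (P2 t * iphi t * iphi t)%C).
  assert (CA : forall t, continuous cA t) by (unfold cA; cont).
  assert (CB : forall t, continuous cB t) by (unfold cB; cont).
  assert (CC : forall t, continuous cC t) by (unfold cC; cont).
  assert (CD : forall t, continuous cD t) by (unfold cD; cont).
  assert (CE : forall t, continuous cE t) by (unfold cE; cont).
  assert (HK : reduced_kernels a P f g p2 r11 r12 r21 r22 cA cB cC cD cE).
  { intros t Ht. unfold cA, cB, cC, cD, cE, iphi.
    rewrite (EP t (proj1 Ht)), (Ef t Ht), (Eg t Ht), (EP2 t Ht), (ER11 t Ht), (ER12 t Ht),
      (ER21 t Ht), (ER22 t Ht).
    pose proof (Hphi t). pose proof (Hs0 t).
    repeat split; try (field; auto). }
  destruct (formal_powers_volterra a P f g p2 r11 r12 r21 r22 cA cB cC cD cE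
              HP Hf0 HK CA CB CC CD CE) as [Hdef Hpow].
  split; [exact Hdef|].
  destruct (volterra_sum P cA cB cC cD cE a lambda HP Ha CA CB CC CD CE)
    as (xi & om & Cxi & Com & Sxi & Som & Eom & Exi).
  set (u := fun t => (f t * xi t)%C).
  set (v := fun t => (g t * xi t + RtoC (P t) * om t / f t)%C).
  exists u, v. split.
  2:{ intros x Hx. assert (Hx' : 0 <= x <= a) by (unfold Ioc0 in Hx; lra).
      assert (Hfact : forall n, RtoC (INR (fact n)) <> RtoC 0).
      { intros n E. apply RtoC_inj in E. pose proof (INR_fact_lt_0 n). lra. }
      pose proof (Hf0 x Hx) as Hfx. split.
      - apply is_series_ext with (2 := is_series_scal (f x) _ _ (Sxi x Hx')).
        intros n. rewrite (proj1 (Hpow n x Hx)). unfold scal; simpl; unfold mult; simpl.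
        Ceq.
        field. apply Hfact.
      - replace (v x) with (g x * xi x + RtoC (P x) / f x * om x)%C
          by (unfold v; field; exact Hfx).
        apply is_series_ext with (2 := is_series_plus _ _ _ _
          (is_series_scal (g x) _ _ (Sxi x Hx'))
          (is_series_scal (RtoC (P x) / f x)%C _ _ (Som x Hx'))).
        intros n. rewrite (proj2 (Hpow n x Hx)).
        unfold plus, scal; simpl; unfold mult; simpl.
        Ceq.
        field. split; [exact Hfx | apply Hfact]. }
  assert (Hslopes : forall x, Ioc0 a x -> _)
    by (intros x Hx; exact (volterra_solution_slopes a kappa P p1 p2 q r11 r12 r21 r22 f g
          cA cB cC cD cE xi om lambda x HP Hf0 HK Hfg CA CB CC CD CE Cxi Com Eom Exi Hx)).
  cbv beta zeta in Hslopes. fold u v in Hslopes.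
  (* The derivatives are named by solving the system for them. Their continuity and asymptotics then
     follow from those of [u] and [v], and no asymptotic relation is differentiated. *)
  set (du := fun x => ((RtoC (kappa / x) + q x) * u x + p2 x * v x
                       - lambda * (r21 x * u x + r22 x * v x))%C).
  set (dv := fun x => (lambda * (r11 x * u x + r12 x * v x) - p1 x * u x
                       - (RtoC (kappa / x) + q x) * v x)%C).
  assert (xi0 : xi 0 = RtoC 1) by (rewrite Exi, wmean_0 by lra; ring).
  assert (om0 : om 0 = RtoC 0) by (rewrite Eom, wmean_0 by lra; ring).
  (* [U] and [V] are u / x^kappa and v / x^kappa continued to 0. Since [V 0 = 0], the leading term
     of [v] lies one order higher and needs the separate limit [Lv]. *)
  set (U := fun x => (phi x * xi x)%C).
  set (V := fun x => (gam x * xi x + om x * iphi x)%C).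
  assert (CU : forall t, continuous U t) by (unfold U; cont).
  assert (CV : forall t, continuous V t) by (unfold V; cont).
  assert (U0 : U 0 = RtoC 1) by (unfold U; rewrite phi0, xi0; ring).
  assert (V0 : V 0 = RtoC 0) by (unfold V; rewrite gam0, om0; ring).
  assert (Eu : forall x, Ioc0 a x -> u x = (cpower x kappa * U x)%C).
  { intros x Hx. unfold u, U. rewrite (Ef x Hx). ring. }
  assert (Ev : forall x, Ioc0 a x -> v x = (cpower x kappa * V x)%C).
  { intros x Hx. unfold v, V, iphi. rewrite (Ef x Hx), (Eg x Hx), (EP x (proj1 Hx)).
    field. split; [apply Hphi | apply Hs0]. }
  assert (Hlim : forall (h H : R -> C) (l : C), (forall x, continuous H x) -> H 0 = l ->
            (forall x, Ioc0 a x -> h x = H x) ->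
            filterlim h (at_right 0) (locally l)).
  { intros h H l CH <- E. apply filterlim_ext_loc with H.
    - generalize (at_right_Ioc0 a Ha). apply filter_imp. intros x Hx. symmetry. now apply E.
    - now apply continuous_at_right. }
  set (mu := ((lambda * r11 0 - p1 0) / RtoC (2 * kappa + 1))%C).
  assert (Lv : filterlim (fun x => v x / cpower x (kappa + 1))%C (at_right 0) (locally mu)).
  { apply filterlim_ext_loc with (fun x => g x / cpower x (kappa + 1) * xi x
       + lambda * (wmean P (fun t => cA t * xi t + cB t * om t)%C x / RtoC x) * iphi x)%C.
    - generalize (at_right_Ioc0 a Ha). apply filter_imp. intros x Hx.
      assert (Hx' : 0 <= x <= a) by (unfold Ioc0 in Hx; lra).
      rewrite (Ev x Hx), (Eg x Hx), cpower_succ by apply Hx.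
      unfold V, iphi. rewrite (Eom x Hx'). field.
      repeat split; [apply Hphi | apply Hs0 |].
      intros E. apply RtoC_inj in E. unfold Ioc0 in Hx. lra.
    (* At 0 the kernel [cA] reduces to [r11 0], because phi(0) = 1 and gam(0) = 0, and [cB] drops
       out with om(0) = 0; the two contributions add up to mu. *)
    - replace mu with (G0 * xi 0 + lambda * ((cA 0%R * xi 0%R + cB 0%R * om 0%R)
          / RtoC (2 * kappa + 1)) * iphi 0)%C.
      2:{ unfold G0, mu, cA, cB, iphi. rewrite phi0, gam0, xi0, om0, R110.
          field. exact H2kC. }
      apply filterlim_Cplus; [typeclasses eauto | |].
      + apply filterlim_Cmult; [typeclasses eauto | exact Lg1 | now apply continuous_at_right].
      + apply filterlim_Cmult; [typeclasses eauto | | now apply continuous_at_right].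
        apply filterlim_Cmult; [typeclasses eauto | apply filterlim_const |].
        apply filterlim_wmean_pospow; [lra | cont]. }
  exists du, dv. split.
  { assert (Hcont : forall h : R -> C, continuous_on (Icc0 a) h -> continuous_on (Ioc0 a) h).
    { intros h. apply continuous_on_subset. unfold Icc0, Ioc0. intros; lra. }
    assert (Cu : continuous_on (Ioc0 a) u).
    { intros x Hx. exact (slope_within_continuous _ _ _ _ (proj1 (Hslopes x Hx))). }
    assert (Cv : continuous_on (Ioc0 a) v).
    { intros x Hx. exact (slope_within_continuous _ _ _ _ (proj2 (Hslopes x Hx))). }
    assert (Ckx : continuous_on (Ioc0 a) (fun x => RtoC (kappa / x))).
    { intros x Hx. apply (continuous_within _ x (fun x => RtoC (kappa / x))).
      apply (filterlim_RtoC (locally x)).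
      apply (ex_derive_continuous (V := R_NormedModule)). auto_derive.
      unfold Ioc0 in Hx. lra. }
    assert (Cp : forall h k, continuous_on (Ioc0 a) h -> continuous_on (Ioc0 a) k ->
              continuous_on (Ioc0 a) (fun x => h x + k x)%C).
    { intros h k Hh Hk x Hx. apply filterlim_Cplus; [typeclasses eauto | now apply Hh | now apply Hk]. }
    assert (Cn : forall h k, continuous_on (Ioc0 a) h -> continuous_on (Ioc0 a) k ->
              continuous_on (Ioc0 a) (fun x => h x - k x)%C).
    { intros h k Hh Hk x Hx. apply filterlim_Cminus; [typeclasses eauto | now apply Hh | now apply Hk]. }
    assert (Cm : forall h k, continuous_on (Ioc0 a) h -> continuous_on (Ioc0 a) k ->
              continuous_on (Ioc0 a) (fun x => h x * k x)%C).
    { intros h k Hh Hk x Hx. apply filterlim_Cmult; [typeclasses eauto | now apply Hh | now apply Hk]. }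
    assert (Cc : continuous_on (Ioc0 a) (fun _ => lambda)).
    { intros x _. apply filterlim_const. }
    split; [|split].
    - split.
      + intros x Hx. apply slope_is_derive_within; [exact Hx | exact (proj1 (Hslopes x Hx))].
      + unfold du.
        apply (Cn (fun x => (RtoC (kappa / x) + q x) * u x + p2 x * v x)%C
                  (fun x => lambda * (r21 x * u x + r22 x * v x))%C).
        * apply (Cp (fun x => (RtoC (kappa / x) + q x) * u x)%C (fun x => p2 x * v x)%C); auto.
        * apply (Cm (fun _ => lambda) (fun x => r21 x * u x + r22 x * v x)%C); auto.
    - split.
      + intros x Hx. apply slope_is_derive_within; [exact Hx | exact (proj2 (Hslopes x Hx))].
      + unfold dv.
        apply (Cn (fun x => lambda * (r11 x * u x + r12 x * v x) - p1 x * u x)%C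
                  (fun x => (RtoC (kappa / x) + q x) * v x)%C); [|auto].
        apply (Cn (fun x => lambda * (r11 x * u x + r12 x * v x))%C (fun x => p1 x * u x)%C);
          [|auto].
        apply (Cm (fun _ => lambda) (fun x => r11 x * u x + r12 x * v x)%C); auto.
    - intros x Hx. unfold du, dv. split; ring. }
  assert (Hsp : forall H : R -> C, (forall x, continuous H x) ->
            forall x, continuous (fun x => RtoC (pospow kappa x) * H x)%C x).
  { intros H CH. apply continuous_weighted; [apply weight_pospow; lra | exact CH]. }
  split; [|split; [|split; [|split; [|split]]]].
  - apply filterlim_bounded_at_0 with (RtoC (pospow kappa 0) * U 0)%C.
    apply (Hlim _ (fun x => RtoC (pospow kappa x) * U x)%C); [now apply Hsp | reflexivity |].
    intros x Hx. rewrite (Eu x Hx), pospow_pos by apply Hx. reflexivity.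
  - apply filterlim_bounded_at_0 with (RtoC (pospow kappa 0) * V 0)%C.
    apply (Hlim _ (fun x => RtoC (pospow kappa x) * V x)%C); [now apply Hsp | reflexivity |].
    intros x Hx. rewrite (Ev x Hx), pospow_pos by apply Hx. reflexivity.
  - apply ratio_asymp_equiv; [exact Hs0|].
    apply (Hlim _ U); [exact CU | exact U0 |].
    intros x Hx. rewrite (Eu x Hx). field. apply Hs0.
  - apply ratio_asymp_equiv.
    { intros x. apply Cmult_neq_0; [exact HkC | apply cpower_neq_0]. }
    assert (Cid : forall x, continuous (fun x => RtoC x) x).
    { intros x. apply (filterlim_RtoC (locally x)), continuous_id. }
    (* Writing x^kappa as x x^(kappa-1) turns kappa / x into kappa, and every other term keeps a
       factor x that vanishes at 0. *)
    apply (Hlim _ (fun x => ((RtoC kappa + RtoC x * Q x) * U x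
       + RtoC x * (P2 x * V x + - lambda * (R21 x * U x + R22 x * V x))) * / RtoC kappa)%C).
    + cont.
    + rewrite U0, V0. field. exact HkC.
    + intros x Hx.
      assert (HxC : RtoC x <> RtoC 0).
      { intros E. apply RtoC_inj in E. unfold Ioc0 in Hx. lra. }
      pose proof (cpower_neq_0 x (kappa - 1)) as Hs1.
      unfold du. rewrite (Eu x Hx), (Ev x Hx), (EP2 x Hx), (EQ x Hx), (ER21 x Hx), (ER22 x Hx).
      replace (cpower x kappa) with (RtoC x * cpower x (kappa - 1))%C.
      2:{ rewrite <- cpower_succ by apply Hx. f_equal. ring. }
      unfold Rdiv. rewrite RtoC_mult, RtoC_inv by (unfold Ioc0 in Hx; lra).
      field. auto.
  - apply ratio_asymp_power. exact Lv.
  - change (asymp_power dv (mu * RtoC (kappa + 1))%C kappa). apply ratio_asymp_power.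
    (* The singular term (kappa / x) v, divided by x^kappa, is kappa v / x^(kappa+1) and tends to
       kappa mu by [Lv]. The rest tends to lambda r11(0) - p1(0) = (2 kappa + 1) mu, and the
       difference is (kappa + 1) mu. *)
    apply filterlim_ext_loc with (fun x => lambda * (R11 x * U x + R12 x * V x)
      - P1 x * U x - (RtoC kappa * (v x / cpower x (kappa + 1)) + Q x * V x))%C.
    + generalize (at_right_Ioc0 a Ha). apply filter_imp. intros x Hx.
      assert (HxC : RtoC x <> RtoC 0).
      { intros E. apply RtoC_inj in E. unfold Ioc0 in Hx. lra. }
      pose proof (Hs0 x).
      unfold dv. rewrite (Eu x Hx), (Ev x Hx), (EP1 x Hx), (EQ x Hx), (ER11 x Hx), (ER12 x Hx).
      rewrite cpower_succ by apply Hx.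
      unfold Rdiv. rewrite RtoC_mult, RtoC_inv by (unfold Ioc0 in Hx; lra).
      field. auto.
    + replace (mu * RtoC (kappa + 1))%C with (lambda * (R11 0%R * U 0%R + R12 0%R * V 0%R)
        - P1 0%R * U 0%R - (RtoC kappa * mu + Q 0%R * V 0%R))%C.
      2:{ rewrite U0, V0, R110, P10. unfold mu.
          assert (E : RtoC (2 * kappa + 1) = (2 * RtoC kappa + 1)%C)
            by now rewrite RtoC_plus, RtoC_mult.
          rewrite E in *. rewrite RtoC_plus. field. exact H2kC. }
      apply filterlim_Cminus; [typeclasses eauto | |].
      * apply (continuous_at_right 0 (fun x => lambda * (R11 x * U x + R12 x * V x) - P1 x * U x)%C).
        apply (filterlim_Cminus (locally 0)).
        -- apply (continuous_Cmult (fun _ => lambda) (fun x => R11 x * U x + R12 x * V x)%C); cont.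
        -- apply (continuous_Cmult P1 U); cont.
      * apply filterlim_Cplus; [typeclasses eauto | |].
        -- apply filterlim_Cmult; [typeclasses eauto | apply filterlim_const | exact Lv].
        -- apply (continuous_at_right 0 (fun x => Q x * V x)%C).
           apply (continuous_Cmult Q V); cont.
Qed.
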